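(* Consider the setting described in the context, and assume A1–A5. Let $f_n=\sum_{j\ge1}\theta_{nj}\phi_j$ with $cn^{-r}\le\|f_n\|\le Cn^{-r}$ for constants $0<c<C$. Then the sequence of alternatives $f_n$ is inconsistent if and only if for every $c_2>0$ $$\sum_{j<c_2k_n}\theta_{nj}^2=o(n^{-2r})\quad\text{as }n\to\infty .$$
   Context: Fix $\sigma>0$, $0<r<1/2$ and an orthonormal basis $(\phi_j)_{j\ge1}$ of $\mathbb{L}_2(0,1)$. For each $n$ one observes $dY_n(t)=f(t)\,dt+\sigma n^{-1/2}dw(t)$, $t\in[0,1]$ ($w$ standard Wiener process, $f\in\mathbb{L}_2(0,1)$ unknown), equivalently $y_j=\theta_j+\sigma n^{-1/2}\xi_j$ with $\theta_j=\int_0^1f\phi_j$, $\xi_j$ i.i.d. $N(0,1)$. The hypothesis is $H_0: f=0$. For each $n$ nonnegative weights $\kappa_{nj}^2$ are given, $\rho_n=\sum_j\kappa_{nj}^2<\infty$, and $T_n(Y_n)=\sum_j\kappa_{nj}^2y_j^2-\sigma^2n^{-1}\rho_n$. Put $k_n=\sup\{k:\sum_{j<k}\kappa_{nj}^2\le\rho_n/2\}$, $\kappa_n^2=\kappa_{nk_n}^2$. Assumptions: (A1) $j\mapsto\kappa_{nj}^2$ is decreasing for each $n$; (A2) $C_1<A_n:=\sigma^{-4}n^2\sum_j\kappa_{nj}^4<C_2$ for all $n$, some $C_1,C_2>0$; (A3) $c_1n^{-2r}\le\rho_n\le c_2n^{-2r}$; (A4) there are $C_1>0,\lambda>1$ with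 $\kappa^2_{n,[(1+\delta)k_n]}<C_1(1+\delta)^{-\lambda}\kappa_n^2$ for all $\delta>0$ and all $n$; (A5) $\kappa_{n1}^2\asymp\kappa_n^2$, and for each $c>1$ there is $C>0$ with $\kappa^2_{n,[ck_n]}\ge C\kappa_n^2$ for all $n$. A test generated by $T_n$ rejects $H_0$ iff $T_n(Y_n)$ exceeds a threshold; $\alpha(K)$, $\beta(K,f)$ are type I and type II error probabilities. A sequence $f_n$ is inconsistent if for every sequence of tests $K_n$ generated by $T_n$, $\liminf_n(\alpha(K_n)+\beta(K_n,f_n))\ge1$. *)

(* Defs.v *)
From HB Require Import structures.
From mathcomp Require Import all_boot all_order all_algebra.
From mathcomp Require Import all_classical all_reals all_analysis.
Set Implicit Arguments.
Unset Strict Implicit.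
Unset Printing Implicit Defensive.
Import Order.TTheory GRing.Theory Num.Theory.
Import numFieldNormedType.Exports.
Local Open Scope classical_set_scope.
Local Open Scope ring_scope.

Definition mutually_independent d (Omega : measurableType d) (R : realType)
  (P : probability Omega R) (X : nat -> {RV P >-> R}) : Prop :=
  forall (J : seq nat) (B : nat -> set R),
    uniq J -> (forall j, measurable (B j)) ->
    P (\bigcap_(j in [set j | j \in J]) (X j @^-1` B j)) =
    (\prod_(j <- J) P (X j @^-1` B j))%E.

Definition iid_std_normal d (Omega : measurableType d) (R : realType)
  (P : probability Omega R) (xi : nat -> {RV P >-> R}) : Prop :=
  mutually_independent xi /\
  forall j (A : set R), measurable A -> distribution P (xi j) A = normal_prob 0 1 A.

(* Coordinates are indexed by j >= 1 (index 0 is ignored).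
   Observations y_j = theta_j + sigma n^{-1/2} xi_j. *)
Definition obs (R : realType) d (Omega : measurableType d) (P : probability Omega R)
  (xi : nat -> {RV P >-> R}) (sigma : R) (n : nat) (theta : nat -> R)
  (j : nat) (w : Omega) : R :=
  theta j + sigma / Num.sqrt (n%:R) * xi j w.

(* T_n(Y_n) = sum_{j>=1} kappa_{nj}^2 y_j^2 - sigma^2 n^{-1} rho_n,
   as an extended real (the series of nonnegative terms is always defined). *)
Definition Tstat (R : realType) d (Omega : measurableType d) (P : probability Omega R)
  (xi : nat -> {RV P >-> R}) (sigma : R) (n : nat) (kappa2 : nat -> R)
  (rho : R) (theta : nat -> R) (w : Omega) : \bar R :=
  ((\sum_(1 <= j <oo) (kappa2 j * (obs xi sigma n theta j w) ^+ 2)%:E)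
     - (sigma ^+ 2 / n%:R * rho)%:E)%E.

(* Test generated by T_n with threshold t: reject H0 iff T_n(Y_n) > t.
   Type I error (f = 0) and type II error (f with coefficients theta). *)
Definition alpha_err (R : realType) d (Omega : measurableType d) (P : probability Omega R)
  (xi : nat -> {RV P >-> R}) (sigma : R) (n : nat) (kappa2 : nat -> R)
  (rho : R) (t : R) : \bar R :=
  P [set w | (t%:E < Tstat xi sigma n kappa2 rho (fun _ => 0%R) w)%E].

Definition beta_err (R : realType) d (Omega : measurableType d) (P : probability Omega R)
  (xi : nat -> {RV P >-> R}) (sigma : R) (n : nat) (kappa2 : nat -> R)
  (rho : R) (t : R) (theta : nat -> R) : \bar R :=
  P [set w | ~ (t%:E < Tstat xi sigma n kappa2 rho theta w)%E].

Definition inconsistent (R : realType) d (Omega : measurableType d) (P : probability Omega R)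
  (xi : nat -> {RV P >-> R}) (sigma : R) (kappa2 : nat -> nat -> R)
  (rho : nat -> R) (theta : nat -> nat -> R) : Prop :=
  forall t : nat -> R,
    (1 <= limn_einf (fun n => alpha_err xi sigma n (kappa2 n) (rho n) (t n)
                              + beta_err xi sigma n (kappa2 n) (rho n) (t n) (theta n)))%E.

(* Main.v *)
Require Import Defs.
From HB Require Import structures.
From mathcomp Require Import all_boot all_order all_algebra.
From mathcomp Require Import all_classical all_reals all_analysis.
From mathcomp Require Import interval_inference measurable_realfun ring lra.
Set Implicit Arguments.
Unset Strict Implicit.
Unset Printing Implicit Defensive.
Import Order.TTheory GRing.Theory Num.Theory.
Import numFieldNormedType.Exports.
Local Open Scope classical_set_scope.
Local Open Scope ring_scope.

(* Write [S = sum_j kappa_j^2 (theta_j + tau xi_j)^2] with [tau = sigma / sqrt n],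
   and [S0] for the same sum with [theta = 0]. Then [S = S0 + mu + L] where
   [mu = sum_j kappa_j^2 theta_j^2] and the linear Gaussian term [L] has standard
   deviation [o(n^{-2})], because [kappa_n^2 ~ n^{2r-2}] and [r < 1/2], while the
   fluctuations of [S0] are exactly of order [n^{-2}].

   If [n^2 mu] does not tend to 0 then, along a subsequence, [S] exceeds [S0] by
   [h ~ n^{-2}] up to a vanishing probability. As [n^2 S0] is tight around its
   mean, some threshold separates [P(S0 > t - h)] from [P(S0 > t)] by a fixed
   amount, and it yields a test with [alpha + beta] bounded away from 1.

   If [n^2 mu] tends to 0, the laws of [S] and [S0] merge as soon as [n^2 S0] does
   not concentrate. To see the latter, multiply the variances of the first [k_n]
   coordinates by [1 + eta / sqrt k_n]: by a second moment computation for the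
   likelihood ratio this moves the law of the sample by [O(eta)] in total
   variation, but with high probability it increases [S0] by at least
   [c eta n^{-2}]. Hence intervals of that length have probability
   [O(eta) + o(1)].

   Conditions (A4) and (A5) translate the behaviour of [n^2 mu] into that of
   [sum_{j < c k_n} theta_j^2]. *)

(** * Densities, scaling and reflection for the standard normal law *)

Section density.
Import HBNNSimple.

(** The density identity for sets passes to simple functions by linearity, and to nonnegative
    measurable [f] by monotone convergence along [nnsfun_approx]. *)
Lemma ge0_integral_density (d : measure_display) (T : measurableType d)
    (R : realType) (m1 m2 : {measure set T -> \bar R}) (p : T -> R)
    (f : T -> \bar R) :
  measurable_fun setT p -> (forall x, 0 <= p x) ->
  (forall A, measurable A -> m2 A = (\int[m1]_(x in A) (p x)%:E)%E) ->
  measurable_fun setT f -> (forall x, (0 <= f x)%E) ->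
  (\int[m2]_x f x = \int[m1]_x (f x * (p x)%:E))%E.
Proof.
move=> mp p0 m2E mf f0.
pose g := nnsfun_approx measurableT mf.
have gE x : limn (fun n => (g n x)%:E) = f x.
  by apply/cvg_lim => //; exact: cvg_nnsfun_approx.
have mgp n : measurable_fun setT (fun x => ((g n x)%:E * (p x)%:E)%E).
  by apply: emeasurable_funM; exact/measurable_EFinP.
transitivity (limn (fun n => \int[m2]_x (g n x)%:E)%E).
  rewrite -monotone_convergence//.
  - by apply: eq_integral => x _; rewrite gE.
  - by move=> n; exact/measurable_EFinP.
  - by move=> n x _; rewrite lee_fin.
  - by move=> x _ a b ab; rewrite lee_fin; exact/lefP/nd_nnsfun_approx.
transitivity (limn (fun n => \int[m1]_x ((g n x)%:E * (p x)%:E))%E); last first.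
  rewrite -monotone_convergence//.
  - apply: eq_integral => x _; rewrite -gE.
    under eq_fun do rewrite muleC.
    rewrite limeMl//; first by rewrite muleC.
    by apply/cvg_ex; exists (f x); exact: cvg_nnsfun_approx.
  - by move=> n x _; rewrite mule_ge0 ?lee_fin.
  - move=> x _ a b ab; rewrite lee_wpmul2r ?lee_fin//.
    exact/lefP/nd_nnsfun_approx.
congr (limn _); apply/funext => n.
rewrite integralT_nnsfun sintegralE.
under eq_integral => x _.
  rewrite fimfunE -fsumEFin// ge0_mule_fsuml; last first.
    by move=> r; rewrite EFinM nnfun_muleindic_ge0.
  over.
rewrite ge0_integral_fsum//; last 2 first.
- move=> r; apply: emeasurable_funM; last exact/measurable_EFinP.
  exact/measurable_EFinP/measurable_funM.
- move=> r x _; apply: mule_ge0; last by rewrite lee_fin.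
  by rewrite EFinM nnfun_muleindic_ge0.
apply: eq_fsbigr => r _.
have mr : measurable (g n @^-1` [set r]) by [].
rewrite m2E// [in LHS]integral_mkcond.
have [r0|r0] := ltP r 0.
  rewrite (_ : g n @^-1` [set r] = set0); last first.
    by apply: preimage_nnfun0.
  rewrite patch_set0 integral0 mule0; apply/esym/integral0_eq => x _.
  by rewrite indic0 mulr0 mul0e.
rewrite -ge0_integralZl//; last 2 first.
  - apply/(measurable_restrictT _ _).1 => //.
    exact/measurable_funTS/measurable_EFinP.
  - by move=> x _; apply: erestrict_ge0 => y _; rewrite lee_fin.
apply: eq_integral => x _; rewrite patchE indicE.
by case: ifPn => _; rewrite ?mulr1 ?mulr0 ?mule0 ?mul0e.
Qed.

End density.

(** Packages the pushforward as an element of the measure type, so that uniqueness theorems for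
    measures apply to it. *)
Lemma pushforward_is_measure (d d' : measure_display) (T : measurableType d)
    (T' : measurableType d') (R : realType) (m : {measure set T -> \bar R})
    (f : T -> T') : measurable_fun setT f ->
  exists m' : {measure set T' -> \bar R}, forall A, m' A = pushforward m f A.
Proof.
move=> mf; pose m' : {measure set T' -> \bar R} :=
  measure_function_pushforward__canonical__measure_function_Measure m mf.
by exists m'.
Qed.

(** After multiplication by [s], the pushforward assigns to each half-open interval its length, and
    Lebesgue measure is determined by these values. *)
Lemma lebesgue_measureZ (R : realType) (s : R) (A : set R) : 0 < s ->
  measurable A ->
  pushforward (@lebesgue_measure R)
    (fun x : measurableTypeR R => s * (x : R) : measurableTypeR R) A =
  ((s^-1)%:E * lebesgue_measure A)%E.
Proof.
move=> s0 mA.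
have ms : measurable_fun setT
    (fun x : measurableTypeR R => s * (x : R) : measurableTypeR R).
  by apply: (@measurable_funM _ (measurableTypeR R)).
have si0 : 0 <= s by exact: ltW.
have [m mE] := pushforward_is_measure (@lebesgue_measure R) ms.
suff -> : lebesgue_measure A = mscale (NngNum si0) m A.
  by rewrite /mscale/= muleA -EFinM mulVf ?gt_eqF// mul1e mE.
apply: lebesgue_measure_unique => // _ [[a b]] _ <-.
rewrite -[RHS]/(s%:E * m `]a, b]%classic)%E mE /pushforward.
have -> : (fun x : R => s * x) @^-1` `]a, b]%classic = `]a / s, b / s]%classic.
  apply/seteqP; split => x /=; rewrite !in_itv/=;
    by rewrite ltr_pdivrMr// ler_pdivlMr// mulrC.
have E : lebesgue_measure `](a / s), (b / s)]%classic =
    (if a < b then ((b - a) / s)%:E else 0%E).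
  rewrite lebesgue_measure_itv/= lte_fin ltr_pM2r ?invr_gt0//.
  by case: ifPn => // _; rewrite -EFinD mulrBl.
transitivity (s%:E * (if (a < b)%R then ((b - a) / s)%:E else 0))%E; last first.
  by rewrite -E.
rewrite lebesgue_measure_itv/= lte_fin.
case: ifPn => _; last by rewrite mule0.
by rewrite -EFinD -EFinM mulrCA mulfV ?gt_eqF// mulr1.
Qed.

Lemma ge0_integral_lebesgueZ (R : realType) (s : R) (f : R -> \bar R) : 0 < s ->
  measurable_fun setT f -> (forall x, (0 <= f x)%E) ->
  (\int[lebesgue_measure]_x f (s * x)%R =
   (s^-1)%:E * \int[lebesgue_measure]_x f x)%E.
Proof.
move=> s0 mf f0.
pose phi := fun x : measurableTypeR R => s * (x : R) : measurableTypeR R.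
have ms : measurable_fun setT phi.
  by apply: (@measurable_funM _ (measurableTypeR R)).
have si0 : 0 <= s^-1 by rewrite invr_ge0 ltW.
transitivity (\int[mscale (NngNum si0) (@lebesgue_measure R)]_x f x)%E; last first.
  by rewrite ge0_integral_mscale.
transitivity (\int[pushforward (@lebesgue_measure R) phi]_x f x)%E.
  by rewrite ge0_integral_pushforward.
apply: eq_measure_integral => A mA _.
by rewrite /mscale/= lebesgue_measureZ.
Qed.

Lemma integral_normalE (R : realType) (f : R -> \bar R) :
  measurable_fun setT f -> (forall x, (0 <= f x)%E) ->
  (\int[normal_prob 0 1]_x f x =
   \int[lebesgue_measure]_x (f x * (normal_pdf 0 1 x)%:E))%E.
Proof.
move=> mf f0.
by apply: (@ge0_integral_density _ (measurableTypeR R)) => //;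
  [exact: measurable_normal_pdf | move=> x; exact: normal_pdf_ge0].
Qed.

Lemma std_normal_pdfE (R : realType) (x : R) :
  normal_pdf 0 1 x = normal_peak 1 * expR (- (x ^+ 2 / 2)).
Proof.
by rewrite normal_pdfE ?oner_eq0// /normal_fun subr0 expr1n mulNr.
Qed.

Lemma integral_normalN (R : realType) (f : R -> \bar R) :
  measurable_fun setT f -> (forall x, (0 <= f x)%E) ->
  (\int[normal_prob 0 1]_x f (- x)%R = \int[normal_prob 0 1]_x f x)%E.
Proof.
move=> mf f0; rewrite !integral_normalE//; last first.
  exact: measurableT_comp.
pose h x := (f x * (normal_pdf 0 1 x)%:E)%E.
have mh : measurable_fun setT h.
  apply: emeasurable_funM => //; apply/measurable_EFinP.
  exact: measurable_normal_pdf.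
have h0 x : (0 <= h x)%E by rewrite mule_ge0// lee_fin normal_pdf_ge0.
transitivity (\int[lebesgue_measure]_x h (- x)%R)%E.
  by apply: eq_integral => x _; rewrite /h !std_normal_pdfE sqrrN.
transitivity (\int[pushforward (@lebesgue_measure R)
    (-%R : _ -> measurableTypeR R)]_x h x)%E.
  by rewrite ge0_integral_pushforward.
by apply: eq_measure_integral => A mA _; exact: lebesgue_measureN.
Qed.

(* The density of N(0, y) with respect to N(0, 1). *)
Definition scale_lr (R : realType) (y x : R) : R :=
  (Num.sqrt y)^-1 * expR (x ^+ 2 / 2 * (1 - y^-1)).

Lemma scale_lr_ge0 (R : realType) (y x : R) : 0 <= scale_lr y x.
Proof. by rewrite mulr_ge0 ?expR_ge0// invr_ge0 sqrtr_ge0. Qed.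

Lemma measurable_scale_lr (R : realType) (y : R) :
  measurable_fun setT (scale_lr y).
Proof.
apply: measurable_funM => //; apply: measurableT_comp => //.
by apply: measurable_funM => //; apply: measurable_funM => //; exact: measurable_funX.
Qed.

(** Substituting [Num.sqrt y * x] in the Lebesgue integral produces the Jacobian [(Num.sqrt y)^-1],
    and the quotient of the two Gaussian exponentials is the exponential in [scale_lr]. *)
Lemma integral_scale_lr (R : realType) (y : R) (f : R -> \bar R) : 0 < y ->
  measurable_fun setT f -> (forall x, (0 <= f x)%E) ->
  (\int[normal_prob 0 1]_x ((scale_lr y x)%:E * f x) =
   \int[normal_prob 0 1]_x f (Num.sqrt y * x)%R)%E.
Proof.
move=> y0 mf f0; have s0 : 0 < Num.sqrt y by rewrite sqrtr_gt0.
rewrite !integral_normalE//; last 3 first.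
- by apply: measurableT_comp => //; exact: measurable_funM.
- apply: emeasurable_funM => //; apply/measurable_EFinP.
  exact: measurable_scale_lr.
- by move=> x; rewrite mule_ge0// lee_fin scale_lr_ge0.
pose h x := (f x * (normal_pdf 0 1 (x / Num.sqrt y))%:E)%E.
have mh : measurable_fun setT h.
  apply: emeasurable_funM => //; apply/measurable_EFinP.
  apply: (@measurableT_comp _ _ _ _ _ _ (normal_pdf 0 1)).
    exact: measurable_normal_pdf.
  exact: measurable_funM.
have h0 x : (0 <= h x)%E by rewrite mule_ge0// lee_fin normal_pdf_ge0.
transitivity (\int[lebesgue_measure]_x h (Num.sqrt y * x)%R)%E; last first.
  apply: eq_integral => x _; rewrite /h; congr (_ * (normal_pdf _ _ _)%:E)%E.
  by rewrite mulrAC mulfV ?gt_eqF// mul1r.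
rewrite ge0_integral_lebesgueZ//.
rewrite -(@ge0_integralZl _ (measurableTypeR R) R lebesgue_measure _ _ h)//.
apply: eq_integral => x _.
rewrite /h muleAC [RHS]muleCA [LHS]muleC -!EFinM; congr (_ * _%:E)%E.
rewrite !std_normal_pdfE /scale_lr mulrACA -expRD.
rewrite [RHS]mulrA; congr (_ * _ * expR _).
rewrite expr_div_n sqr_sqrtr ?ltW//; field.
by rewrite gt_eqF.
Qed.

Lemma integral_normal1 (R : realType) (c : R) :
  (\int[normal_prob 0 1]_(x in [set: R]) c%:E = c%:E)%E.
Proof.
by rewrite integral_cst// [X in (_ * X)%E]probability_setT mule1.
Qed.

Lemma integral_scale_lr1 (R : realType) (y : R) : 0 < y ->
  (\int[normal_prob 0 1]_x (scale_lr y x)%:E = 1)%E.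
Proof.
move=> y0.
have := @integral_scale_lr R y (cst 1%E) y0.
under eq_integral do rewrite mule1.
by move=> -> //; rewrite (@integral_normal1 R 1).
Qed.

(** One factor of the square is absorbed by rescaling the variable. What remains is proportional to
    [exp(x t^2 / 2)], hence to the likelihood ratio for variance [(1 - x)^-1], whose integral is 1;
    finiteness requires [x < 1]. *)
Lemma integral_scale_lr_sqr (R : realType) (x : R) : 0 <= x -> x < 1 ->
  (\int[normal_prob 0 1]_t ((scale_lr (1 + x) t) ^+ 2)%:E =
   ((Num.sqrt (1 - x ^+ 2))^-1)%:E)%E.
Proof.
move=> x0 x1.
have y0 : 0 < 1 + x by lra.
have z0 : 0 < (1 - x)^-1 by rewrite invr_gt0; lra.
pose z := (1 - x)^-1.
pose c := (Num.sqrt (1 + x))^-1 * Num.sqrt z.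
have c0 : 0 <= c by rewrite mulr_ge0 ?invr_ge0 ?sqrtr_ge0.
transitivity (\int[normal_prob 0 1]_t (c%:E * (scale_lr z t)%:E))%E; last first.
  rewrite ge0_integralZl//; last 2 first.
  - by apply/measurable_EFinP; exact: measurable_scale_lr.
  - by move=> t _; rewrite lee_fin scale_lr_ge0.
  rewrite [X in (_ * X)%E](integral_scale_lr1 z0) mule1; congr EFin.
  rewrite /c /z (_ : 1 - x ^+ 2 = (1 + x) * (1 - x)); last by ring.
  by rewrite sqrtrM ?ltW// invfM sqrtrV//; lra.
under eq_integral do rewrite expr2 EFinM.
rewrite integral_scale_lr//; last 2 first.
- by apply/measurable_EFinP; exact: measurable_scale_lr.
- by move=> t; rewrite lee_fin scale_lr_ge0.
apply: eq_integral => t _; rewrite -EFinM; congr EFin.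
rewrite /scale_lr /c mulrA -[_ * _ * (Num.sqrt z)^-1]mulrA mulfV ?mulr1; last first.
  by rewrite gt_eqF// sqrtr_gt0.
congr (_ * expR _); rewrite exprMn sqr_sqrtr ?ltW// /z invrK; field.
by rewrite gt_eqF.
Qed.

(** * Centred functions of a normal variable and their second moments *)

(** Encodes that [g] has mean 0 and variance [m] under N(0,1). The free shift [y] is the partial sum
    over earlier coordinates in the induction for sums, and the integrands are nonnegative, so no
    integrability conditions arise there. *)
Definition shift_norm2 (R : realType) (g : R -> R) (m : R) : Prop :=
  forall y c, (\int[normal_prob 0 1]_x ((y + c * g x) ^+ 2)%:E =
    (y ^+ 2 + c ^+ 2 * m)%:E)%E.

(** Squaring [x^2 / 8 <= exp(x^2 / 8)] gives [x^4 <= 64 exp(x^2 / 4)], and the right side is a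
    multiple of [scale_lr 2], which integrates to 1. *)
Lemma integrable_normal_X4 (R : realType) :
  (normal_prob 0 1).-integrable setT (fun x : R => (x ^+ 4)%:E).
Proof.
have H : (normal_prob 0 1).-integrable setT
    (fun x : R => ((64 * Num.sqrt 2) * scale_lr 2 x)%:E).
  under eq_fun do rewrite EFinM.
  apply: integrableZl => //; apply/integrableP; split.
    by apply/measurable_EFinP; exact: measurable_scale_lr.
  under eq_integral do rewrite gee0_abs ?lee_fin ?scale_lr_ge0//.
  by rewrite integral_scale_lr1// ltry.
apply: le_integrable H => //.
  by apply/measurable_EFinP; exact: measurable_funX.
move=> x _ /=; rewrite lee_fin !ger0_norm; last 2 first.
- by rewrite mulr_ge0 ?scale_lr_ge0// mulr_ge0// sqrtr_ge0.
- by rewrite (exprM x 2 2) sqr_ge0.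
rewrite /scale_lr mulrA mulfK; last by rewrite gt_eqF// sqrtr_gt0.
have -> : x ^+ 2 / 2 * (1 - 2^-1) = x ^+ 2 / 8 + x ^+ 2 / 8 by field.
rewrite expRD.
have := @expR_ge1Dx R (x ^+ 2 / 8).
have := sqr_ge0 x.
rewrite (exprM x 2 2).
set u := x ^+ 2; set e := expR _ => u0 ue.
have ue' : u / 8 <= e by lra.
have u8 : 0 <= u / 8 by lra.
have := ler_pM u8 u8 ue' ue'.
by rewrite expr2; lra.
Qed.

Lemma normal_integrable_sqr (R : realType) (g : R -> R) :
  measurable_fun setT g ->
  (normal_prob 0 1).-integrable setT (fun x : R => (g x ^+ 2)%:E) ->
  (normal_prob 0 1).-integrable setT (fun x : R => (g x)%:E).
Proof.
move=> mg ig2.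
have H : (normal_prob 0 1).-integrable setT (fun x : R => (1 + g x ^+ 2)%:E).
  under eq_fun do rewrite EFinD.
  apply: integrableD => //; exact: finite_measure_integrable_cst.
apply: le_integrable H => //; first exact/measurable_EFinP.
move=> x _ /=; rewrite lee_fin [leRHS]ger0_norm; last by rewrite addr_ge0 ?sqr_ge0.
rewrite -(real_normK (num_real (g x))).
by have := normr_ge0 (g x); set u := `|g x|; nra.
Qed.

Lemma normal_shift_norm2 (R : realType) (g : R -> R) :
  measurable_fun setT g ->
  (normal_prob 0 1).-integrable setT (fun x : R => (g x ^+ 2)%:E) ->
  (\int[normal_prob 0 1]_x (g x)%:E = 0)%E ->
  exists2 m : R, 0 <= m & shift_norm2 g m.
Proof.
move=> mg ig2 g0.
have ig := normal_integrable_sqr mg ig2.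
have fin : (\int[normal_prob 0 1]_x (g x ^+ 2)%:E)%E \is a fin_num.
  exact: integrable_fin_num.
exists (fine (\int[normal_prob 0 1]_x (g x ^+ 2)%:E)%E).
  by apply: fine_ge0; apply: integral_ge0 => x _; rewrite lee_fin sqr_ge0.
move=> y c.
transitivity (\int[normal_prob 0 1]_x ((y ^+ 2)%:E +
   ((2 * y * c)%:E * (g x)%:E + (c ^+ 2)%:E * (g x ^+ 2)%:E)))%E.
  apply: eq_integral => x _; rewrite -!EFinM -!EFinD; congr EFin; ring.
rewrite integralD//; last 2 first.
- exact: finite_measure_integrable_cst.
- by apply: integrableD => //; apply: integrableZl.
rewrite integralD//; [|exact: integrableZl..].
rewrite !integralZl// g0 mule0 add0e integral_normal1.
by rewrite EFinD [X in (_ = _ + X)%E]EFinM fineK.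
Qed.

Lemma integrable_normal_X2 (R : realType) :
  (normal_prob 0 1).-integrable setT (fun x : R => (x ^+ 2)%:E).
Proof.
apply: normal_integrable_sqr; first exact: measurable_funX.
by under eq_fun do rewrite -exprM; exact: integrable_normal_X4.
Qed.

(** The mean vanishes by symmetry: positive and negative parts have equal finite integrals. The
    variance is kept as an unspecified constant, since only bounds are needed. *)
Lemma normal_shift_norm2_id (R : realType) :
  exists2 m : R, 0 <= m & shift_norm2 (fun x => x) m.
Proof.
have i1 : (normal_prob 0 1).-integrable setT (fun x : R => x%:E).
  exact: (@normal_integrable_sqr R (fun x => x)) (integrable_normal_X2 R).
apply: normal_shift_norm2 => //; first exact: integrable_normal_X2.
rewrite integralE.
have -> : (\int[normal_prob 0 1]_x ((fun x : R => x%:E)^\- x) =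
    \int[normal_prob 0 1]_x ((fun x : R => x%:E)^\+ x))%E.
  rewrite -[RHS]integral_normalN//; last first.
    by apply: measurable_funepos; exact/measurable_EFinP.
  by apply: eq_integral => x _; rewrite funenegE funeposE EFinN.
rewrite subee//; apply: integrable_fin_num => //.
exact: integrable_funepos.
Qed.

(** Here [v] is the second moment of N(0,1), of which only positivity is recorded. Integrating [sqrt
    2 * (1 - x^2 / 2) <= sqrt 2 * exp(- x^2 / 2) = scale_lr 2^-1 x] gives
    [sqrt 2 <= 1 + (sqrt 2 / 2) v], which excludes [v <= 0]. *)
Lemma normal_shift_norm2_sqr (R : realType) :
  exists v : R, 0 < v /\
    exists2 m : R, 0 <= m & shift_norm2 (fun x => x ^+ 2 - v) m.
Proof.
have i2 := integrable_normal_X2 R.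
pose I := (\int[normal_prob 0 1]_(x in [set: R]) (x ^+ 2)%:E)%E.
have finI : I \is a fin_num by exact: integrable_fin_num.
exists (fine I); split.
  have s2 : 0 <= Num.sqrt 2 :> R by exact: sqrtr_ge0.
  have s22 : Num.sqrt 2 * Num.sqrt 2 = 2 :> R by rewrite -expr2 sqr_sqrtr.
  have : ((Num.sqrt 2)%:E <= \int[normal_prob 0 1]_(x in [set: R])
     ((scale_lr 2^-1 x)%:E + (Num.sqrt 2 / 2)%:E * (x ^+ 2)%:E))%E.
    rewrite -[leLHS](@integral_normal1 R); apply: ge0_le_integral => //.
    - apply/emeasurable_funD; last apply/emeasurable_funM => //.
        by apply/measurable_EFinP; exact: measurable_scale_lr.
      by apply/measurable_EFinP; exact: measurable_funX.
    - move=> x _; rewrite -EFinM -EFinD lee_fin /scale_lr invrK sqrtrV// invrK.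
      have -> : x ^+ 2 / 2 * (1 - 2) = - (x ^+ 2 / 2) by ring.
      have := @expR_ge1Dx R (- (x ^+ 2 / 2)).
      move=> /(ler_wpM2l s2); set u := x ^+ 2; lra.
  rewrite ge0_integralD//; last 4 first.
  - by move=> x _; rewrite lee_fin scale_lr_ge0.
  - by apply/measurable_EFinP; exact: measurable_scale_lr.
  - by move=> x _; rewrite mule_ge0 ?lee_fin ?divr_ge0 ?sqr_ge0.
  - apply/emeasurable_funM => //.
    by apply/measurable_EFinP; exact: measurable_funX.
  rewrite integralZl// [X in (X + _)%E](@integral_scale_lr1 R) ?invr_gt0//.
  rewrite -[X in (_ * X)%E]/I -(fineK finI) -EFinM -EFinD lee_fin.
  move: s2 s22; set s := Num.sqrt 2; set v := fine I => s2 s22 h.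
  rewrite ltNge; apply/negP => v0.
  have : s / 2 * v <= 0 by rewrite mulr_ge0_le0// divr_ge0.
  by nra.
apply: normal_shift_norm2.
- by apply: measurable_funB => //; exact: measurable_funX.
- have H : (normal_prob 0 1).-integrable setT
      (fun x : R => (x ^+ 4 + (fine I) ^+ 2)%:E).
    under eq_fun do rewrite EFinD.
    apply: integrableD => //; first exact: integrable_normal_X4.
    exact: finite_measure_integrable_cst.
  have v0 : 0 <= fine I.
    by apply: fine_ge0; apply: integral_ge0 => x _; rewrite lee_fin sqr_ge0.
  apply: le_integrable H => //.
    apply/measurable_EFinP; apply: measurable_funX.
    by apply: measurable_funB => //; exact: measurable_funX.
  move=> x _ /=; rewrite lee_fin !ger0_norm ?sqr_ge0//; last first.
    by rewrite addr_ge0 ?sqr_ge0// (exprM x 2 2) sqr_ge0.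
  rewrite (exprM x 2 2); have := sqr_ge0 x.
  by move: v0; set v := fine I; set u := x ^+ 2; nra.
- under eq_integral do rewrite EFinB.
  rewrite integralB//; last exact: finite_measure_integrable_cst.
  by rewrite integral_normal1 -[X in (X - _)%E]/I -(fineK finI) -EFinB subrr.
Qed.

(** * Independence of one coordinate from all the others *)

Section independence.
Context (d : measure_display) (Omega : measurableType d) (R : realType).
Context (P : probability Omega R) (xi : nat -> {RV P >-> R}).
Hypothesis iid : iid_std_normal xi.

(** A pi-system on which [mutually_independent] applies directly; uniqueness of measures then
    extends independence from [xi k] to the sigma-algebra it generates. *)
Definition rect_except (k : nat) : set (set Omega) :=
  [set A | exists (J : seq nat) (B : nat -> set R),
    [/\ uniq J, k \notin J, forall j, measurable (B j) &
        A = \bigcap_(j in [set j | j \in J]) (xi j @^-1` B j)]].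

(* [Omega] with the sigma-algebra generated by all [xi j], [j <> k]. *)
Definition others (k : nat) := g_sigma_algebraType (rect_except k).

Lemma rect_except_measurable k : rect_except k `<=` measurable.
Proof.
move=> _ [J [B [_ _ mB ->]]]; apply: fin_bigcap_measurable.
  exact: finite_seq.
by move=> j _; rewrite -[_ @^-1` _]setTI; exact: measurable_funPT.
Qed.

Lemma rect_exceptI k : setI_closed (rect_except k).
Proof.
move=> _ _ [J [B [uJ kJ mB ->]]] [J' [B' [uJ' kJ' mB' ->]]].
exists (undup (J ++ J')), (fun j => (if j \in J then B j else setT) `&`
  (if j \in J' then B' j else setT)); split.
- exact: undup_uniq.
- by rewrite mem_undup mem_cat negb_or kJ.
- by move=> j; apply: measurableI; case: ifP.
apply/seteqP; split => w /=.
  move=> [h h'] j /=; rewrite mem_undup mem_cat => _; split.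
    by case: ifPn => // jJ; exact: h.
  by case: ifPn => // jJ; exact: h'.
move=> h; split => j /= jJ.
  by have [] := h j; rewrite /= ?mem_undup ?mem_cat ?jJ.
by have [] := h j; rewrite /= ?mem_undup ?mem_cat ?jJ ?orbT.
Qed.

Lemma rect_exceptT k : rect_except k setT.
Proof.
exists [::], (fun=> setT); split => //.
by apply/esym/seteqP; split => // w _ j.
Qed.

Lemma sub_measurable_others k (A : set (others k)) :
  measurable A -> measurable (A : set Omega).
Proof.
exact: (smallest_sub (@sigma_algebra_measurable _ Omega)
  (@rect_except_measurable k)).
Qed.

(** As functions of [A], both sides are finite measures; they agree on the pi-system
    [rect_except k], hence on the generated sigma-algebra. *)
Lemma indep_others k (B : set R) (A : set (others k)) :
  measurable B -> measurable A ->
  P ((xi k @^-1` B) `&` A) = (P (xi k @^-1` B) * P A)%E.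
Proof.
move=> mB mA.
have mk : measurable (xi k @^-1` B).
  by rewrite -[_ @^-1` _]setTI; exact: measurable_funPT.
have p0 : 0 <= fine (P (xi k @^-1` B)) by exact: fine_ge0.
have pE : (fine (P (xi k @^-1` B)))%:E = P (xi k @^-1` B).
  by rewrite fineK// fin_num_measure.
pose m1 : {measure set Omega -> \bar R} := mrestr P mk.
pose m2 : {measure set Omega -> \bar R} := mscale (NngNum p0) P.
have m1E X : m1 X = P (X `&` xi k @^-1` B) by [].
have m2E X : m2 X = (P (xi k @^-1` B) * P X)%E by rewrite -pE.
rewrite setIC -m1E -m2E.
apply: (g_sigma_algebra_measure_unique (rect_except k) _ (fun=> setT)) => //.
- exact: rect_except_measurable.
- by move=> _; exact: rect_exceptT.
- by apply/seteqP; split => // w _; exists 0%N.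
- exact: rect_exceptI.
- move=> _ [J [C [uJ kJ mC ->]]].
  rewrite m1E m2E.
  (* Inserting [B] at coordinate [k] turns the intersection into one rectangle over [k :: J]. *)
  pose D j := if j == k then B else C j.
  have mD j : measurable (D j) by rewrite /D; case: ifP.
  have -> : \bigcap_(j in [set j | j \in J]) (xi j @^-1` C j) `&` xi k @^-1` B =
      \bigcap_(j in [set j | j \in k :: J]) (xi j @^-1` D j).
    apply/seteqP; split => w /=.
      move=> [h hk] j /=; rewrite inE /D; case: eqP => [-> _ //|_ /= jJ].
      exact: h.
    move=> h; split => [j /= jJ|].
      have := h j; rewrite /= inE jJ orbT /D.
      by case: eqP => [jk|_]; [move: kJ; rewrite -jk jJ|exact].
    by have := h k; rewrite /= inE eqxx /D eqxx; exact.
  have [ind _] := iid.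
  rewrite ind//=; last by rewrite kJ.
  rewrite ind// big_cons {1}/D eqxx; congr (_ * _)%E.
  rewrite big_seq_cond [RHS]big_seq_cond; apply: eq_bigr => j /andP[jJ _].
  by rewrite /D; case: eqP => // jk; move: kJ; rewrite -jk jJ.
- by move=> _; rewrite m1E setTI -ge0_fin_numE// fin_num_measure.
Qed.

Lemma measurable_xi_others k j : j != k ->
  measurable_fun setT (xi j : others k -> R).
Proof.
move=> jk _ B mB; rewrite setTI; apply: sub_sigma_algebra.
exists [:: j], (fun=> B); split => //; first by rewrite inE eq_sym.
apply/seteqP; split => w /= h; last by apply: (h j); rewrite /= inE.
by move=> i /=; rewrite inE => /eqP ->.
Qed.

(** The pair formed by [xi k] and the identity into [others k] has a product law, so Tonelli
    integrates [xi k] out while everything depending on the other coordinates stays fixed. *)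
Lemma integral_indep k (F : R * others k -> \bar R) :
  measurable_fun setT F -> (forall z, (0 <= F z)%E) ->
  (\int[P]_w F (xi k w, w) = \int[P]_w \int[normal_prob 0 1]_x F (x, w))%E.
Proof.
move=> mF F0.
have mid : measurable_fun setT (fun w : Omega => w : others k).
  by move=> _ A mA; rewrite setTI; exact: (@sub_measurable_others k A mA).
pose idk : {mfun Omega >-> others k} :=
  HB.pack (fun w : Omega => w : others k)
    (isMeasurableFun.Build _ _ _ _ _ mid).
have mpair : measurable_fun setT (fun w : Omega => (xi k w, w : others k)).
  by apply: measurable_fun_pair.
have [m mE] := pushforward_is_measure P mpair.
have lawE X : measurable X -> (distribution P (xi k) \x distribution P idk)%E X = m X.
  apply: product_measure_unique => A B mA mB.
  by rewrite mE -indep_others.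
transitivity (\int[pushforward P
    (fun w : Omega => (xi k w, w : others k))]_z F z)%E.
  by rewrite ge0_integral_pushforward.
transitivity (\int[(distribution P (xi k) \x distribution P idk)]_z F z)%E.
  apply: eq_measure_integral => X mX _.
  exact: etrans (esym (mE X)) (esym (lawE X mX)).
rewrite fubini_tonelli2// ge0_integral_distribution//; last 2 first.
- by apply: measurable_fun_fubini_tonelli_G.
- by move=> w; apply: integral_ge0.
apply: eq_integral => w _ /=; rewrite /fubini_G.
(* The identity reconciles the measurable structure carried by [normal_prob] with the one on which
   the law of [xi k] lives. *)
pose iota := fun x : measurableTypeR R => x : R.
have miota : measurable_fun setT iota by move=> _ A mA; rewrite setTI.
have mFw : measurable_fun setT (fun x => F (x, w)).
  exact: measurableT_comp mF (measurable_fun_pair _ _).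
transitivity (\int[pushforward (normal_prob 0 1) iota]_x F (x, w))%E.
  apply: eq_measure_integral => A mA _; have [_ law] := iid.
  exact: (law k A mA).
by rewrite ge0_integral_pushforward.
Qed.

End independence.

(** * Sums and likelihood ratios built from independent coordinates *)

(** Measurability is asked only inside the summation range, because on [others k] the coordinate [k]
    itself need not be measurable. *)
Lemma measurable_sum_nat (d : measure_display) (T : measurableType d)
    (R : realType) (h : nat -> T -> R) (a b : nat) :
  (forall i, (a <= i < b)%N -> measurable_fun setT (h i)) ->
  measurable_fun setT (fun x => \sum_(a <= i < b) h i x).
Proof.
move=> mh.
have -> : (fun x => \sum_(a <= i < b) h i x) =
    (fun x => \sum_(a <= i < b) (if (a <= i < b)%N then h i x else 0)).
  by apply/funext => x; rewrite big_nat [RHS]big_nat; apply: eq_bigr => i ->.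
by apply: measurable_sum => i; case: (a <= i < b)%N (mh i) => [/(_ isT)|_].
Qed.

Lemma measurable_prod_nat (d : measure_display) (T : measurableType d)
    (R : realType) (h : nat -> T -> R) (a b : nat) :
  (forall i, (a <= i < b)%N -> measurable_fun setT (h i)) ->
  measurable_fun setT (fun x => \prod_(a <= i < b) h i x).
Proof.
by move=> mh; apply: measurable_prod => i; rewrite mem_index_iota; exact: mh.
Qed.

Section gaussian_sums.
Context (d : measure_display) (Omega : measurableType d) (R : realType).
Context (P : probability Omega R) (xi : nat -> {RV P >-> R}).
Hypothesis iid : iid_std_normal xi.

Lemma integral_prob_cst (c : R) : (\int[P]_(w in [set: Omega]) c%:E = c%:E)%E.
Proof. by rewrite integral_cst// [X in (_ * X)%E]probability_setT mule1. Qed.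

(** Orthogonality by induction: integrating out the last coordinate, with the previous partial sum
    as the shift in [shift_norm2], adds exactly [m] times the square of its coefficient. *)
Lemma integral_sum_sqr (g : R -> R) (m : R) (c : nat -> R) (N : nat) :
  measurable_fun setT g -> 0 <= m -> shift_norm2 g m ->
  (\int[P]_w ((\sum_(1 <= j < N) c j * g (xi j w)) ^+ 2)%:E =
   (m * \sum_(1 <= j < N) c j ^+ 2)%:E)%E.
Proof.
move=> mg m0 gm.
have [->|N0] := posnP N.
  under eq_integral do rewrite big_geq// expr0n/=.
  by rewrite integral0 big_geq// mulr0.
rewrite -(prednK N0); elim: N.-1 => [|k IH].
  under eq_integral do rewrite big_geq// expr0n/=.
  by rewrite integral0 big_geq// mulr0.
pose X w := \sum_(1 <= j < k.+1) c j * g (xi j w).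
transitivity (\int[P]_w ((X w + c k.+1 * g (xi k.+1 w)) ^+ 2)%:E)%E.
  by apply: eq_integral => w _; rewrite big_nat_recr.
have mX : measurable_fun setT (X : others xi k.+1 -> R).
  apply: measurable_sum_nat => j /andP[_ jk]; apply: measurable_funM => //.
  by apply: measurableT_comp => //; apply: measurable_xi_others; rewrite ltn_eqF.
have mXO : measurable_fun setT X.
  apply: measurable_sum_nat => j /andP[_ jk]; apply: measurable_funM => //.
  exact: measurableT_comp.
rewrite (integral_indep iid (F := fun z => ((X z.2 + c k.+1 * g z.1) ^+ 2)%:E)).
- under eq_integral do rewrite /= gm EFinD.
  rewrite ge0_integralD//; last 3 first.
  + by move=> w _; rewrite lee_fin sqr_ge0.
  + by apply/measurable_EFinP; exact: measurable_funX.
  + by move=> w _; rewrite lee_fin mulr_ge0// sqr_ge0.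
  rewrite IH integral_prob_cst -EFinD [in RHS]big_nat_recr//=.
  by congr EFin; ring.
- apply/measurable_EFinP; apply: measurable_funX; apply: measurable_funD.
    exact: measurableT_comp.
  by apply: measurable_funM => //; exact: measurableT_comp.
- by move=> z; rewrite lee_fin sqr_ge0.
Qed.

Lemma chebyshev_sum (g : R -> R) (m : R) (c : nat -> R) (N : nat) (h : R)
    (A : set Omega) :
  measurable_fun setT g -> 0 <= m -> shift_norm2 g m -> 0 < h ->
  measurable A ->
  (forall w, A w -> h <= `|\sum_(1 <= j < N) c j * g (xi j w)|) ->
  (P A <= (m * (\sum_(1 <= j < N) c j ^+ 2) / h ^+ 2)%:E)%E.
Proof.
move=> mg m0 gm h0 mA hA.
have h2 : 0 < h ^+ 2 by rewrite exprn_gt0.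
rewrite mulrC EFinM -(integral_sum_sqr c N mg m0 gm) lee_pdivlMl//.
have -> : ((h ^+ 2)%:E * P A = \int[P]_w ((h ^+ 2)%:E * (\1_A w)%:E))%E.
  rewrite ge0_integralZl ?integral_indic ?setIT//; last by rewrite lee_fin ltW.
  exact/measurable_EFinP.
apply: ge0_le_integral => //.
- by move=> w _; rewrite mule_ge0 ?lee_fin// ltW.
- by apply: emeasurable_funM => //; exact/measurable_EFinP.
- apply/measurable_EFinP; apply: measurable_funX; apply: measurable_sum_nat => j _.
  by apply: measurable_funM => //; exact: measurableT_comp.
- move=> w _; rewrite -EFinM lee_fin indicE.
  have [/set_mem Aw|_] := boolP (w \in A); last by rewrite mulr0 sqr_ge0.
  rewrite mulr1 -[leRHS]real_normK ?num_real//.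
  by apply: lerXn2r; rewrite ?nnegrE ?(ltW h0)//; exact: hA.
Qed.

(** The likelihood ratio, with respect to [P], of the law under which coordinate [j < k] has
    variance [y j]. *)
Definition lr_prod (y : nat -> R) (k : nat) (w : Omega) : R :=
  \prod_(1 <= j < k) scale_lr (y j) (xi j w).

Lemma lr_prod_ge0 y k w : 0 <= lr_prod y k w.
Proof. by apply: prodr_ge0 => j _; exact: scale_lr_ge0. Qed.

Lemma measurable_lr_prod y k : measurable_fun setT (lr_prod y k).
Proof.
apply: measurable_prod_nat => j _; apply: measurableT_comp => //.
exact: measurable_scale_lr.
Qed.

Lemma measurable_lr_prod_others y k :
  measurable_fun setT (lr_prod y k : others xi k -> R).
Proof.
apply: measurable_prod_nat => j /andP[_ jk]; apply: measurableT_comp => //.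
  exact: measurable_scale_lr.
by apply: measurable_xi_others; rewrite ltn_eqF.
Qed.

(** A hybrid step: coordinates below [k] are already reweighted and those from [k] on are still
    rescaled. Integrating out [xi k] exchanges its rescaling for a factor [scale_lr (y k)]. *)
Lemma integral_lr_prod_step (y a : nat -> R) (H : R -> R) (k N : nat) :
  (forall j, 0 < y j) -> measurable_fun setT H -> (forall z, 0 <= H z) ->
  (1 <= k < N)%N ->
  (\int[P]_w (lr_prod y k w * H (\sum_(1 <= j < k) a j * xi j w ^+ 2 +
       \sum_(k <= j < N) a j * y j * xi j w ^+ 2))%:E =
   \int[P]_w (lr_prod y k.+1 w * H (\sum_(1 <= j < k.+1) a j * xi j w ^+ 2 +
       \sum_(k.+1 <= j < N) a j * y j * xi j w ^+ 2))%:E)%E.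
Proof.
move=> y0 mH H0 /andP[k0 kN].
pose Z w := \sum_(1 <= j < k) a j * xi j w ^+ 2 +
       \sum_(k.+1 <= j < N) a j * y j * xi j w ^+ 2.
have mZ : measurable_fun setT (Z : others xi k -> R).
  apply: measurable_funD; apply: measurable_sum_nat => j /andP[j1 j2];
    apply: measurable_funM => //; apply: measurable_funX;
    apply: measurable_xi_others; [by rewrite ltn_eqF|by rewrite gtn_eqF].
have mL := @measurable_lr_prod_others y k.
pose F1 (z : R * others xi k) :=
  (lr_prod y k z.2 * H (Z z.2 + a k * y k * z.1 ^+ 2))%:E.
pose F2 (z : R * others xi k) :=
  (scale_lr (y k) z.1 * (lr_prod y k z.2 * H (Z z.2 + a k * z.1 ^+ 2)))%:E.
have mF b : measurable_fun setT (fun z : R * others xi k =>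
    lr_prod y k z.2 * H (Z z.2 + b * z.1 ^+ 2)).
  apply: measurable_funM; first exact: measurableT_comp mL _.
  apply: measurableT_comp mH _; apply: measurable_funD.
    exact: measurableT_comp mZ _.
  by apply: measurable_funM => //; exact: measurable_funX.
have F10 z : (0 <= F1 z)%E by rewrite lee_fin mulr_ge0// lr_prod_ge0.
have F20 z : (0 <= F2 z)%E.
  by rewrite lee_fin !mulr_ge0 ?scale_lr_ge0// lr_prod_ge0.
transitivity (\int[P]_w F1 (xi k w, w))%E.
  apply: eq_integral => w _; rewrite /F1/= /Z (big_ltn kN).
  by rewrite addrCA [in RHS]addrC.
transitivity (\int[P]_w F2 (xi k w, w))%E; last first.
  apply: eq_integral => w _; rewrite /F2/= /Z /lr_prod !big_nat_recr//=.
  congr EFin; rewrite mulrA [_ * scale_lr _ _]mulrC; congr (_ * H _).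
  by rewrite addrAC.
rewrite !(integral_indep iid)//; last first.
- by apply/measurable_EFinP; exact: mF.
- apply/measurable_EFinP; apply: measurable_funM; last exact: mF.
  by apply: measurableT_comp => //; exact: measurable_scale_lr.
apply: eq_integral => w _.
pose f x := (lr_prod y k w * H (Z w + a k * x ^+ 2))%:E.
transitivity (\int[normal_prob 0 1]_x f (Num.sqrt (y k) * x)%R)%E.
  apply: eq_integral => x _; rewrite /f /F1/= exprMn sqr_sqrtr ?ltW//.
  by rewrite [a k * (y k * _)]mulrA.
have mf : measurable_fun setT f.
  apply/measurable_EFinP; apply: measurable_funM => //.
  apply: measurableT_comp => //; apply: measurable_funD => //.
  by apply: measurable_funM => //; exact: measurable_funX.
have f0 x : (0 <= f x)%E by rewrite lee_fin mulr_ge0// lr_prod_ge0.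
transitivity (\int[normal_prob 0 1]_x ((scale_lr (y k) x)%:E * f x))%E.
  by rewrite (integral_scale_lr (y0 k) mf f0).
by apply: eq_integral => x _; rewrite /f /F2 -EFinM.
Qed.

(** Change of measure: applying the exchange to the coordinates one after another replaces all
    rescalings by the full likelihood ratio. *)
Lemma integral_lr_prod (y a : nat -> R) (H : R -> R) (N : nat) :
  (forall j, 0 < y j) -> measurable_fun setT H -> (forall z, 0 <= H z) ->
  (\int[P]_w (H (\sum_(1 <= j < N) a j * y j * xi j w ^+ 2))%:E =
   \int[P]_w (lr_prod y N w * H (\sum_(1 <= j < N) a j * xi j w ^+ 2))%:E)%E.
Proof.
move=> y0 mH H0.
have [->|N0] := posnP N.
  by apply: eq_integral => w _; rewrite /lr_prod !big_geq// mul1r.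
have step k : (k < N)%N ->
  (\int[P]_w (H (\sum_(1 <= j < N) a j * y j * xi j w ^+ 2))%:E =
   \int[P]_w (lr_prod y k.+1 w * H (\sum_(1 <= j < k.+1) a j * xi j w ^+ 2 +
       \sum_(k.+1 <= j < N) a j * y j * xi j w ^+ 2))%:E)%E.
  elim: k => [_|k IH kN].
    by apply: eq_integral => w _; rewrite /lr_prod !(big_geq (leqnn _)) mul1r add0r.
  rewrite (IH (ltnW kN)).
  by apply: (@integral_lr_prod_step y a H k.+1 N y0 mH H0); rewrite kN.
rewrite (step N.-1) ?prednK//.
by apply: eq_integral => w _; rewrite [X in H (_ + X)]big_geq// addr0.
Qed.

Lemma integral_lr_prod_sqr (y q : nat -> R) (N : nat) :
  (forall j, (\int[normal_prob 0 1]_t (scale_lr (y j) t ^+ 2)%:E = (q j)%:E)%E) ->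
  (\int[P]_w (lr_prod y N w ^+ 2)%:E = (\prod_(1 <= j < N) q j)%:E)%E.
Proof.
move=> yq.
have base k : (k <= 1)%N ->
  (\int[P]_w (lr_prod y k w ^+ 2)%:E = (\prod_(1 <= j < k) q j)%:E)%E.
  move=> k1; rewrite /lr_prod; under eq_integral do rewrite big_geq// expr1n.
  by rewrite big_geq// integral_prob_cst.
case: N => [|N]; first exact: base.
elim: N => [|k IH]; first exact: base.
have mL := @measurable_lr_prod_others y k.+1.
pose F (z : R * others xi k.+1) :=
  ((lr_prod y k.+1 z.2 ^+ 2)%:E * (scale_lr (y k.+1) z.1 ^+ 2)%:E)%E.
transitivity (\int[P]_w F (xi k.+1 w, w))%E.
  apply: eq_integral => w _; rewrite /F /lr_prod/= big_nat_recr//=.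
  by rewrite -EFinM -exprMn.
rewrite (integral_indep iid)//.
- under eq_integral => w _.
    rewrite /F/= ge0_integralZl//; last 3 first.
    + apply/measurable_EFinP; apply: measurable_funX; exact: measurable_scale_lr.
    + by move=> x _; rewrite lee_fin sqr_ge0.
    + by rewrite lee_fin sqr_ge0.
    rewrite yq; over.
  rewrite ge0_integralZr//.
  + by rewrite IH -EFinM [in RHS]big_nat_recr.
  + apply/measurable_EFinP; apply: measurable_funX; exact: measurable_lr_prod.
  + by move=> x _; rewrite lee_fin sqr_ge0.
  + by rewrite -yq; apply: integral_ge0 => x _; rewrite lee_fin sqr_ge0.
- apply: emeasurable_funM; apply/measurable_EFinP; apply: measurable_funX.
    exact: measurableT_comp mL _.
  by apply: measurableT_comp => //; exact: measurable_scale_lr.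
- by move=> z; rewrite mule_ge0// lee_fin sqr_ge0.
Qed.

End gaussian_sums.

(** * Anticoncentration of weighted sums of squares by inflating variances *)

Lemma bernoulli_ineq (R : realType) (x : R) (K : nat) : 0 <= x -> x <= 1 ->
  1 - K%:R * x <= (1 - x) ^+ K.
Proof.
move=> x0 x1; elim: K => [|K IH]; first by rewrite mul0r subr0 expr0.
rewrite exprS -natr1.
have := ler_wpM2l (_ : 0 <= 1 - x) IH.
have K0 : 0 <= K%:R :> R by [].
have : 0 <= K%:R * x * x by rewrite !mulr_ge0.
move=> h /(_ _); rewrite subr_ge0 => /(_ x1); lra.
Qed.

Section anticoncentration.
Context (d : measure_display) (Omega : measurableType d) (R : realType).
Context (P : probability Omega R) (xi : nat -> {RV P >-> R}).
Hypothesis iid : iid_std_normal xi.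

Lemma integral_lr_prod1 (y : nat -> R) (N : nat) : (forall j, 0 < y j) ->
  (\int[P]_w (lr_prod xi y N w)%:E = 1)%E.
Proof.
move=> y0.
have := @integral_lr_prod _ _ _ _ _ iid y (fun=> 0) (cst 1) N y0 _ _.
rewrite integral_prob_cst => -> //.
by apply: eq_integral => w _; rewrite mulr1.
Qed.

(* By AM-GM, [2 (L - 1) <= eta + (L - 1)^2 / eta] for the likelihood ratio [L]. *)
Lemma integral_lr_prod_le (y : nat -> R) (N : nat) (eta : R) (A : set Omega) :
  (forall j, 0 < y j) -> 0 < eta -> measurable A ->
  (\int[P]_w (lr_prod xi y N w ^+ 2)%:E <= (1 + 2 * eta ^+ 2)%:E)%E ->
  (\int[P]_w (lr_prod xi y N w * \1_A w)%:E <= P A + (3 / 2 * eta)%:E)%E.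
Proof.
move=> y0 e0 mA L2.
pose L := lr_prod xi y N.
have mL : measurable_fun setT L by exact: measurable_lr_prod.
have L0 w : 0 <= L w by exact: lr_prod_ge0.
have e1 : 0 <= eta^-1 by rewrite invr_ge0 ltW.
have mA' : measurable_fun setT (\1_A : Omega -> R) by exact: measurable_indic.
(* The square is expanded and the term [- L / eta] moved to the left, so that all integrands are
   nonnegative. With [E L = 1] the constants then add up to [eta / 2 + eta]. *)
have : (\int[P]_w ((L w * \1_A w)%:E + (eta^-1)%:E * (L w)%:E) <=
  \int[P]_w ((\1_A w)%:E + ((eta / 2 + eta^-1 / 2)%:E +
     (eta^-1 / 2)%:E * (L w ^+ 2)%:E)))%E.
  apply: ge0_le_integral => //.
  - by move=> w _; rewrite -EFinM -EFinD lee_fin addr_ge0// mulr_ge0// indicE.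
  - apply: emeasurable_funD; first by apply/measurable_EFinP; exact: measurable_funM.
    by apply: emeasurable_funM => //; exact/measurable_EFinP.
  - apply: emeasurable_funD; first exact/measurable_EFinP.
    apply: emeasurable_funD => //; apply: emeasurable_funM => //.
    by apply/measurable_EFinP; exact: measurable_funX.
  - move=> w _; rewrite -!EFinM -!EFinD lee_fin indicE.
    have : (w \in A)%:R = 0 :> R \/ (w \in A)%:R = 1 :> R by case: (w \in A); auto.
    have ee : eta * eta^-1 = 1 by rewrite mulfV ?gt_eqF.
    move: (L0 w) e0 e1 ee; set l := L w; set i := (_)%:R; set f := eta^-1.
    move=> l0 e0 f0 ee [->|->].
      have : 0 <= f * (l - 1) ^+ 2 by rewrite mulr_ge0// sqr_ge0.
      by rewrite mulr0 !add0r; nra.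
    have h : 0 <= f * (eta - (l - 1)) ^+ 2 by rewrite mulr_ge0// sqr_ge0.
    have : f * (eta - (l - 1)) ^+ 2 =
      (eta * f) * (eta - 2 * (l - 1)) + f * (l - 1) ^+ 2 by ring.
    by rewrite ee; nra.
rewrite ge0_integralD//; last 4 first.
- by move=> w _; rewrite lee_fin mulr_ge0// indicE.
- by apply/measurable_EFinP; exact: measurable_funM.
- by move=> w _; rewrite mule_ge0// lee_fin.
- by apply: emeasurable_funM => //; exact/measurable_EFinP.
rewrite ge0_integralZl//; last 2 first.
- exact/measurable_EFinP.
- by move=> w _; rewrite lee_fin.
rewrite integral_lr_prod1// mule1.
rewrite ge0_integralD//; last 3 first.
- exact/measurable_EFinP.
- by move=> w _; rewrite -EFinM -EFinD lee_fin !addr_ge0 ?mulr_ge0 ?sqr_ge0// ltW.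
- apply: emeasurable_funD => //; apply: emeasurable_funM => //.
  by apply/measurable_EFinP; exact: measurable_funX.
rewrite integral_indic// setIT.
rewrite ge0_integralD//; last 3 first.
- by move=> w _; rewrite lee_fin !addr_ge0 ?mulr_ge0// ltW.
- by move=> w _; rewrite -EFinM lee_fin !mulr_ge0 ?sqr_ge0.
- apply: emeasurable_funM => //.
  by apply/measurable_EFinP; exact: measurable_funX.
rewrite integral_prob_cst ge0_integralZl//; last 3 first.
- by apply/measurable_EFinP; exact: measurable_funX.
- by move=> w _; rewrite lee_fin sqr_ge0.
- by rewrite lee_fin mulr_ge0.
move=> h; rewrite -(@leeD2rE _ (eta^-1)%:E)//; apply: le_trans h _.
rewrite -addeA; apply: leeD2l.
have : ((eta^-1 / 2)%:E * \int[P]_w (L w ^+ 2)%:E <=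
  (eta^-1 / 2)%:E * (1 + 2 * eta ^+ 2)%:E)%E.
  by apply: lee_wpmul2l => //; rewrite lee_fin mulr_ge0.
move=> /(leeD2l (eta / 2 + eta^-1 / 2)%:E) h; apply: le_trans h _.
rewrite -EFinM -!EFinD lee_fin le_eqVlt; apply/orP; left; apply/eqP.
by field; rewrite gt_eqF.
Qed.

(** Multiplying the variances of the first [K] coordinates by [1 + x], where [x = eta / sqrt K],
    turns the sum [S] into [S + x * SK]. If [S > u - h], then either [S + x * SK > u] or
    [x * SK < h]; the first event has the probability of [S > u] under the changed law, within
    [3 / 2 * eta] of the original one from above. *)
Lemma anticoncentration (a : nat -> R) (N K : nat) (eta u h : R) :
  (0 < K < N)%N -> 0 < eta -> eta ^+ 2 <= 2^-1 ->
  (P [set w | (u - h < \sum_(1 <= j < N) a j * xi j w ^+ 2)%R] <=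
   P [set w | (u < \sum_(1 <= j < N) a j * xi j w ^+ 2)%R] + (3 / 2 * eta)%:E +
   P [set w | (eta / Num.sqrt K%:R *
                 \sum_(1 <= j < K.+1) a j * xi j w ^+ 2 < h)%R])%E.
Proof.
move=> /andP[K0 KN] e0 e2.
pose x := eta / Num.sqrt K%:R.
have K0R : 0 < K%:R :> R by rewrite ltr0n.
have sK : 0 < Num.sqrt K%:R :> R by rewrite sqrtr_gt0.
have x0 : 0 < x by rewrite divr_gt0.
have Kx : K%:R * x ^+ 2 = eta ^+ 2.
  by rewrite /x expr_div_n sqr_sqrtr ?ltW// mulrCA mulfV ?gt_eqF// mulr1.
have x2 : x ^+ 2 <= 2^-1.
  apply: le_trans e2; rewrite -Kx ler_peMl ?sqr_ge0//.
  by rewrite ler1n.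
have x1 : x < 1.
  by rewrite ltNge; apply/negP => x1; have := x2; rewrite expr2; nra.
pose xj j := if (j <= K)%N then x else 0.
have xj0 j : 0 <= xj j by rewrite /xj; case: ifP => // _; exact: ltW.
have xj1 j : xj j < 1 by rewrite /xj; case: ifP.
pose y j := 1 + xj j.
have y0 j : 0 < y j by rewrite /y; have := xj0 j; lra.
pose S w := \sum_(1 <= j < N) a j * xi j w ^+ 2.
pose SK w := \sum_(1 <= j < K.+1) a j * xi j w ^+ 2.
have mS n : measurable_fun setT
    (fun w => \sum_(1 <= j < n) a j * xi j w ^+ 2).
  by apply: measurable_sum_nat => j _; apply: measurable_funM => //;
    exact: measurable_funX.
have SyE w : \sum_(1 <= j < N) a j * y j * xi j w ^+ 2 = S w + x * SK w.
  rewrite /S /SK !(@big_cat_nat _ _ _ K.+1 1 N)//= mulr_sumr [RHS]addrAC -big_split/=.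
  congr (_ + _); apply: eq_big_nat => j /andP[j1 jK].
    by rewrite /y /xj -ltnS jK; ring.
  by rewrite /y /xj leqNgt j1 /= addr0 mulr1.
pose A := [set w | u < S w].
have mgt (f : Omega -> R) c : measurable_fun setT f -> measurable [set w | c < f w].
  move=> mf; rewrite (_ : [set w | c < f w] = f @^-1` `]c, +oo[%classic).
    by rewrite -[X in measurable X]setTI; apply: mf => //; exact: measurable_itv.
  by apply/seteqP; split => w /=; rewrite in_itv/= andbT.
have mA : measurable A by apply: mgt; exact: mS.
have mlt : measurable [set w | x * SK w < h].
  rewrite (_ : [set w | x * SK w < h] = [set w | - h < - (x * SK w)]).
    apply: mgt; apply: measurable_funN; apply: measurable_funM => //.
    exact: mS.
  by apply/seteqP; split => w /=; rewrite ltrN2.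
have mSh : measurable [set w | u - h < S w] by apply: mgt; exact: mS.
have mSy : measurable [set w | u < S w + x * SK w].
  apply: mgt; apply: measurable_funD; first exact: mS.
  by apply: measurable_funM => //; exact: mS.
have step1 : (P [set w | (u - h < S w)%R] <=
    P [set w | (u < S w + x * SK w)%R] + P [set w | (x * SK w < h)%R])%E.
  apply: le_trans (measureU2 _ _ _) => //.
  apply: le_measure; rewrite ?inE//; first exact: measurableU.
  move=> w /= uS; have [hx|hx] := leP h (x * SK w); [left|right] => //.
  lra.
apply: le_trans step1 _; apply: leeD2r.
have -> : P [set w | u < S w + x * SK w] =
    (\int[P]_w (lr_prod xi y N w * \1_A w)%:E)%E.
  have mH : measurable_fun setT (\1_(`]u, +oo[%classic : set R) : R -> R).
    exact: measurable_indic.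
  have := integral_lr_prod iid a N y0 mH (fun z => _).
  under eq_integral do rewrite SyE.
  have -> : (\int[P]_w (\1_(`]u, +oo[%classic : set R) (S w + x * SK w))%:E)%E =
      P [set w | u < S w + x * SK w].
    rewrite -[X in P X]setIT -integral_indic//; apply: eq_integral => w _.
    congr EFin; rewrite !indicE; congr ((nat_of_bool _)%:R).
    by apply/idP/idP; rewrite !inE/= in_itv/= andbT.
  move=> ->; last by move=> z; rewrite indicE.
  apply: eq_integral => w _; congr EFin; rewrite !indicE; congr (_ * (nat_of_bool _)%:R).
  by apply/idP/idP; rewrite !inE/= in_itv/= andbT.
apply: integral_lr_prod_le => //.
rewrite (integral_lr_prod_sqr iid N
  (q := fun j => (Num.sqrt (1 - xj j ^+ 2))^-1)); last first.
  by move=> j; rewrite integral_scale_lr_sqr.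
rewrite lee_fin (@big_cat_nat _ _ _ K.+1 1 N)//=.
rewrite [X in _ * X]big1_seq ?mulr1; last first.
  move=> j /andP[_]; rewrite mem_index_iota => /andP[Kj _].
  by rewrite /xj leqNgt Kj/= expr0n/= subr0 sqrtr1 invr1.
rewrite (eq_big_nat _ _ (F2 := fun=> (Num.sqrt (1 - x ^+ 2))^-1)); last first.
  by move=> j /andP[_ jK]; rewrite /xj -ltnS jK.
rewrite prodr_const_nat subn1/= exprVn.
(* The second moment of the likelihood ratio is [(1 - x^2)^(-K/2)]. Since [K x^2 = eta^2], Bernoulli
   bounds it by [1 / (1 - eta^2)], which is at most [1 + 2 eta^2] because [eta^2 <= 1/2]. *)
have tK : 2^-1 <= 1 - eta ^+ 2 by lra.
have := @bernoulli_ineq R (x ^+ 2) K (sqr_ge0 x); rewrite Kx => /(_ _) B.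
have {}B : 1 - eta ^+ 2 <= (1 - x ^+ 2) ^+ K by apply: B; lra.
have t0 : 0 <= 1 - x ^+ 2 by lra.
have t1 : (1 - x ^+ 2) ^+ K <= Num.sqrt (1 - x ^+ 2) ^+ K.
  rewrite lerXn2r ?nnegrE ?sqrtr_ge0//.
  rewrite -[leLHS]sqr_sqrtr// expr2 ler_piMr ?sqrtr_ge0//.
  by rewrite -[leRHS]sqrtr1 ler_wsqrtr//; have := sqr_ge0 x; lra.
have sq0 : 0 < Num.sqrt (1 - x ^+ 2) ^+ K.
  by apply: lt_le_trans t1; apply: lt_le_trans B; lra.
rewrite -[leLHS]mul1r ler_pdivrMr//.
have : (1 + 2 * eta ^+ 2) * (1 - eta ^+ 2) <=
  (1 + 2 * eta ^+ 2) * Num.sqrt (1 - x ^+ 2) ^+ K.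
  rewrite ler_wpM2l//; last exact: le_trans B t1.
  by have := sqr_ge0 eta; lra.
apply: le_trans; have := sqr_ge0 eta; move: e2; set e := eta ^+ 2; nra.
Qed.

End anticoncentration.

(** * Lower limits, and truncation of the random series *)

Lemma ge_limn_einf (R : realType) (u : (\bar R)^nat) (l : R) :
  (forall e, 0 < e -> \forall n \near \oo, ((l - e)%:E <= u n)%E) ->
  (l%:E <= limn_einf u)%E.
Proof.
move=> h; rewrite limn_einf_lim (cvg_lim _ (@cvg_einfs_sup _ u))//.
apply/lee_addgt0Pr => e e0; have [N _ hN] := h e e0.
rewrite -leeBlDr// -EFinB; apply: le_ereal_sup_tmp; exists (einfs u N) => //.
by apply: le_ereal_inf_tmp => _ [k Nk <-]; exact: hN.
Qed.

Lemma limn_einf_gt (R : realType) (u : (\bar R)^nat) (l : R) :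
  (l%:E <= limn_einf u)%E ->
  forall e, 0 < e -> \forall n \near \oo, ((l - e)%:E < u n)%E.
Proof.
rewrite limn_einf_lim (cvg_lim _ (@cvg_einfs_sup _ u))// => h e e0.
have : ((l - e)%:E < ereal_sup (range (einfs u)))%E.
  by apply: lt_le_trans h; rewrite lte_fin; lra.
move=> /ereal_sup_gt[_ [N _ <-]] lt; exists N => // k /= Nk.
by apply: lt_le_trans lt _; apply: ereal_inf_lbound; exists k.
Qed.

Section truncation.
Context (d : measure_display) (Omega : measurableType d) (R : realType).
Context (P : probability Omega R).

Definition pr (A : set Omega) : R := fine (P A).

Lemma prE A : measurable A -> P A = (pr A)%:E.
Proof. by move=> mA; rewrite fineK// fin_num_measure. Qed.

Lemma pr_leU A B C : measurable A -> measurable B -> measurable C ->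
  A `<=` B `|` C -> pr A <= pr B + pr C.
Proof.
move=> mA mB mC ABC; rewrite -lee_fin EFinD -!prE//.
apply: le_trans (measureU2 _ _ _) => //.
by apply: le_measure; rewrite ?inE//; exact: measurableU.
Qed.

Lemma pr_setC A : measurable A -> pr (~` A) = 1 - pr A.
Proof.
move=> mA; apply: EFin_inj; rewrite -prE; last exact: measurableC.
by rewrite probability_setC// EFinB -prE.
Qed.

Lemma measurable_gt (f : Omega -> R) (c : R) :
  measurable_fun setT f -> measurable [set w | c < f w].
Proof.
move=> mf; rewrite (_ : [set w | c < f w] = f @^-1` `]c, +oo[%classic).
  by rewrite -[X in measurable X]setTI; apply: mf => //; exact: measurable_itv.
by apply/seteqP; split => w /=; rewrite in_itv/= andbT.
Qed.

Lemma measurable_ge (f : Omega -> R) (c : R) :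
  measurable_fun setT f -> measurable [set w | c <= f w].
Proof.
move=> mf; rewrite (_ : [set w | c <= f w] = f @^-1` `[c, +oo[%classic).
  by rewrite -[X in measurable X]setTI; apply: mf => //; exact: measurable_itv.
by apply/seteqP; split => w /=; rewrite in_itv/= andbT.
Qed.

Variables (X : nat -> Omega -> R) (t c : R).
Hypothesis mX : forall j, measurable_fun setT (X j).
Hypothesis X0 : forall j w, 0 <= X j w.

(** For nonnegative terms a strict lower bound on the series is already attained by some partial
    sum, so the rejection event is a countable union of events about finite sums. *)
Lemma series_gtE :
  [set w | (t%:E < \sum_(1 <= j <oo) (X j w)%:E - c%:E)%E] =
  \bigcup_N [set w | t + c < \sum_(1 <= j < N) X j w].
Proof.
have E w : (t%:E < \sum_(1 <= j <oo) (X j w)%:E - c%:E)%E =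
    ((t + c)%:E < \sum_(1 <= j <oo) (X j w)%:E)%E.
  by rewrite lteBrDr.
apply/seteqP; split => w; rewrite [X in X -> _]/= [X in _ -> X]/= E.
  move=> h; apply: contrapT => hN; move: h; apply/negP; rewrite -leNgt.
  apply: lime_le; first by apply: is_cvg_nneseries => j _ _; rewrite lee_fin.
  near=> N; rewrite sumEFin lee_fin leNgt; apply/negP => h.
  by apply: hN; exists N.
move=> [N _ /= h]; apply: lt_le_trans (nneseries_lim_ge N _).
  by rewrite sumEFin lte_fin; exact: h.
by move=> j _ _; rewrite lee_fin.
Unshelve. all: by end_near. Qed.

Lemma measurable_series_gt :
  measurable [set w | (t%:E < \sum_(1 <= j <oo) (X j w)%:E - c%:E)%E].
Proof.
rewrite series_gtE; apply: bigcupT_measurable => N; apply: measurable_gt.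
exact: measurable_sum_nat.
Qed.

(** Continuity from below along this increasing union; it carries bounds on finite sums over to the
    full statistic. *)
Lemma pr_series_cvg :
  (fun N => pr [set w | t + c < \sum_(1 <= j < N) X j w]) @ \oo -->
  pr [set w | (t%:E < \sum_(1 <= j <oo) (X j w)%:E - c%:E)%E].
Proof.
have mN N : measurable [set w | t + c < \sum_(1 <= j < N) X j w].
  by apply: measurable_gt; exact: measurable_sum_nat.
have mU : measurable (\bigcup_N [set w | t + c < \sum_(1 <= j < N) X j w]).
  by apply: bigcupT_measurable.
rewrite series_gtE; apply: fine_cvg; rewrite fineK ?fin_num_measure//.
apply: nondecreasing_cvg_mu => // N N' NN'; apply/subsetPset => w /= h.
apply: (lt_le_trans h); case: N NN' {h} => [|N] NN'.
  by rewrite big_geq// sumr_ge0.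
by rewrite (@big_cat_nat _ _ _ N.+1 1 N')//= lerDl sumr_ge0.
Qed.

End truncation.

(** * Tail comparisons for the truncated quadratic statistic *)

Section truncated_statistic.
Context (d : measure_display) (Omega : measurableType d) (R : realType).
Context (P : probability Omega R) (xi : nat -> {RV P >-> R}).
Hypothesis iid : iid_std_normal xi.
Variables (K : nat -> R) (tau : R).

Local Notation pr := (pr P).

Definition qsum (theta : nat -> R) (N : nat) (w : Omega) : R :=
  \sum_(1 <= j < N) K j * (theta j + tau * xi j w) ^+ 2.

Local Notation qsum0 := (qsum (fun=> 0)).

Lemma qsum0E N w : qsum0 N w = \sum_(1 <= j < N) (tau ^+ 2 * K j) * xi j w ^+ 2.
Proof. by apply: eq_bigr => j _; rewrite add0r; ring. Qed.

Lemma qsumE theta N w : qsum theta N w = qsum0 N w +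
  \sum_(1 <= j < N) (2 * tau * (K j * theta j)) * xi j w +
  \sum_(1 <= j < N) K j * theta j ^+ 2.
Proof.
by rewrite /qsum -!big_split/=; apply: eq_bigr => j _; rewrite add0r; ring.
Qed.

Lemma measurable_qsum theta N : measurable_fun setT (qsum theta N).
Proof.
apply: measurable_sum_nat => j _; apply: measurable_funM => //.
apply: measurable_funX; apply: measurable_funD => //.
exact: measurable_funM.
Qed.

Lemma measurable_lin (c : nat -> R) N :
  measurable_fun setT (fun w => \sum_(1 <= j < N) c j * xi j w).
Proof.
by apply: measurable_sum_nat => j _; exact: measurable_funM.
Qed.

Lemma pr_cross_ge (m h : R) theta N (A : set Omega) :
  0 <= m -> shift_norm2 (fun x : R => x) m -> 0 < h -> measurable A ->
  (forall w, A w ->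
    h <= `|\sum_(1 <= j < N) (2 * tau * (K j * theta j)) * xi j w|) ->
  pr A <= m * (4 * tau ^+ 2 * \sum_(1 <= j < N) (K j * theta j) ^+ 2) / h ^+ 2.
Proof.
move=> m0 mE h0 mA hA; rewrite -lee_fin -prE//.
have := @chebyshev_sum _ _ _ _ _ iid (fun x => x) m
  (fun j => 2 * tau * (K j * theta j)) N h A (@measurable_id _ _ _) m0 mE h0 mA hA.
rewrite (_ : 4 * tau ^+ 2 * _ =
  \sum_(1 <= j < N) (2 * tau * (K j * theta j)) ^+ 2)//.
by rewrite mulr_sumr; apply: eq_bigr => j _; ring.
Qed.

(** When the signal contributes at most [h / 2], the sum can exceed [u] only if the null sum exceeds
    [u - h] or the linear term reaches [h / 2]; Chebyshev bounds the latter. *)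
Lemma pr_qsum_le (m u h : R) theta N :
  0 <= m -> shift_norm2 (fun x : R => x) m -> 0 < h ->
  \sum_(1 <= j < N) K j * theta j ^+ 2 <= h / 2 ->
  pr [set w | u < qsum theta N w] <= pr [set w | u - h < qsum0 N w] +
    m * (4 * tau ^+ 2 * \sum_(1 <= j < N) (K j * theta j) ^+ 2) / (h / 2) ^+ 2.
Proof.
move=> m0 mE h0 mu.
pose L w := \sum_(1 <= j < N) (2 * tau * (K j * theta j)) * xi j w.
have mA : measurable [set w | h / 2 <= L w].
  by apply: measurable_ge; exact: measurable_lin.
have := @pr_leU _ _ _ P [set w | u < qsum theta N w] [set w | u - h < qsum0 N w]
  [set w | h / 2 <= L w].
move=> /(_ _ _ mA _)H; apply: le_trans (H _ _ _) _.
- by apply: measurable_gt; exact: measurable_qsum.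
- by apply: measurable_gt; exact: measurable_qsum.
- move=> w /=; rewrite (qsumE theta) -/(L w) => uq.
  by have [hL|hL] := leP (h / 2) (L w); [right|left] => //; lra.
rewrite lerD2l; apply: pr_cross_ge => //; first by lra.
by move=> w /= hL; apply: le_trans hL _; exact: ler_norm.
Qed.

(** A signal of size [2 * h] compensates both the lowered threshold and a linear term above [- h];
    Chebyshev handles a smaller linear term. *)
Lemma pr_qsum_ge (m u h : R) theta N :
  0 <= m -> shift_norm2 (fun x : R => x) m -> 0 < h ->
  2 * h <= \sum_(1 <= j < N) K j * theta j ^+ 2 ->
  pr [set w | u - h < qsum0 N w] <= pr [set w | u < qsum theta N w] +
    m * (4 * tau ^+ 2 * \sum_(1 <= j < N) (K j * theta j) ^+ 2) / h ^+ 2.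
Proof.
move=> m0 mE h0 mu.
pose L w := \sum_(1 <= j < N) (2 * tau * (K j * theta j)) * xi j w.
have mA : measurable [set w | h <= - L w].
  by apply: measurable_ge; apply: measurable_funN; exact: measurable_lin.
have := @pr_leU _ _ _ P [set w | u - h < qsum0 N w] [set w | u < qsum theta N w]
  [set w | h <= - L w].
move=> /(_ _ _ mA _)H; apply: le_trans (H _ _ _) _.
- by apply: measurable_gt; exact: measurable_qsum.
- by apply: measurable_gt; exact: measurable_qsum.
- move=> w /=; rewrite (qsumE theta) -/(L w) => uq.
  by have [hL|hL] := leP h (- L w); [right|left] => //; lra.
rewrite lerD2l; apply: pr_cross_ge => //.
by move=> w /= hL; rewrite -normrN; apply: le_trans hL _; exact: ler_norm.
Qed.

Lemma pr_sqr_ge (v m h : R) (a : nat -> R) N (A : set Omega) :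
  0 <= m -> shift_norm2 (fun x : R => x ^+ 2 - v) m -> 0 < h -> measurable A ->
  (forall w, A w -> h <= `|\sum_(1 <= j < N) a j * xi j w ^+ 2 -
                           v * \sum_(1 <= j < N) a j|) ->
  pr A <= m * (\sum_(1 <= j < N) a j ^+ 2) / h ^+ 2.
Proof.
move=> m0 mE h0 mA hA; rewrite -lee_fin -prE//.
apply: (@chebyshev_sum _ _ _ _ _ iid _ m a N h A _ m0 mE h0 mA).
  by apply: measurable_funB => //; exact: measurable_funX.
move=> w Aw; apply: le_trans (hA w Aw) _.
rewrite le_eqVlt; apply/orP; left; apply/eqP; congr (`|_|).
by rewrite mulr_sumr -sumrB; apply: eq_bigr => j _; ring.
Qed.

(** The hypothesis on [h] confines the exceptional event of [anticoncentration] to the first [k]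
    squares summing to less than half their mean. Their weights are comparable up to [b], so
    Chebyshev gives a probability of order [1 / k]. *)
Lemma pr_qsum0_anticoncentration (v m b kap eta u h : R) (k N : nat) :
  0 < v -> 0 <= m -> shift_norm2 (fun x : R => x ^+ 2 - v) m ->
  (0 < k < N)%N -> 0 < eta -> eta ^+ 2 <= 2^-1 -> 0 < tau -> 0 < kap ->
  (forall j, (0 < j <= k)%N -> kap <= K j /\ K j <= b * kap) ->
  h <= eta / Num.sqrt k%:R * (v / 2 * (k%:R * (tau ^+ 2 * kap))) ->
  pr [set w | u - h < qsum0 N w] <=
    pr [set w | u < qsum0 N w] + 3 / 2 * eta + 4 * m * b ^+ 2 / (v ^+ 2 * k%:R).
Proof.
move=> v0 m0 mE kN e0 e2 t0 kap0 Kb hle.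
have [k0 _] := andP kN.
have k0R : 0 < k%:R :> R by rewrite ltr0n.
pose a j := tau ^+ 2 * K j.
pose x := eta / Num.sqrt k%:R.
have x0 : 0 < x by rewrite divr_gt0// sqrtr_gt0.
pose Q w := x * \sum_(1 <= j < k.+1) a j * xi j w ^+ 2.
have ma n : measurable_fun setT (fun w => \sum_(1 <= j < n) a j * xi j w ^+ 2).
  by apply: measurable_sum_nat => j _; apply: measurable_funM => //;
    exact: measurable_funX.
have mQf : measurable_fun setT Q.
  by apply: measurable_funM; [exact: measurable_cst|exact: ma].
have mQ : measurable [set w | Q w < h].
  rewrite (_ : [set w | Q w < h] = [set w | - h < - Q w]).
    by apply: measurable_gt; exact: measurable_funN.
  by apply/seteqP; split => w /=; rewrite ltrN2.
have := anticoncentration iid a u h kN e0 e2.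
have eqS c : [set w | c < \sum_(1 <= j < N) a j * xi j w ^+ 2] =
    [set w | c < qsum0 N w].
  by apply/seteqP; split => w /=; rewrite qsum0E.
rewrite !eqS -/x (prE P mQ) !prE; try by apply: measurable_gt; exact: measurable_qsum.
rewrite -!EFinD lee_fin => /le_trans; apply; rewrite lerD2l.
pose sa := \sum_(1 <= j < k.+1) a j.
have t2 : 0 < tau ^+ 2 by rewrite exprn_gt0.
have sage : k%:R * (tau ^+ 2 * kap) <= sa.
  rewrite mulr_natl -[X in _ *+ X](subn1 k.+1) -sumr_const_nat.
  apply: ler_sum_nat => j /andP[j1 jk]; rewrite /a ler_wpM2l ?(ltW t2)//.
  by have [] := Kb j; rewrite // j1 -ltnS.
have p0 : 0 < k%:R * (tau ^+ 2 * kap) by rewrite !mulr_gt0.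
have sa0 : 0 < sa by exact: lt_le_trans sage.
have sa2 : \sum_(1 <= j < k.+1) a j ^+ 2 <= k%:R * (tau ^+ 2 * (b * kap)) ^+ 2.
  rewrite mulr_natl -[X in _ *+ X](subn1 k.+1) -sumr_const_nat.
  apply: ler_sum_nat => j /andP[j1 jk].
  have [Kj1 Kj2] : kap <= K j /\ K j <= b * kap by apply: Kb; rewrite j1 -ltnS.
  have Kj0 : 0 <= K j by exact: le_trans (ltW kap0) Kj1.
  have a0 : 0 <= a j by rewrite mulr_ge0 ?(ltW t2).
  have ale : a j <= tau ^+ 2 * (b * kap) by rewrite /a ler_wpM2l ?(ltW t2).
  by apply: lerXn2r; rewrite ?nnegrE// (le_trans a0).
apply: le_trans (@pr_sqr_ge v m (v / 2 * sa) a k.+1 _ m0 mE _ mQ _) _.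
- by rewrite mulr_gt0// divr_gt0.
- move=> w /= Qh; rewrite -/sa ler_normr; apply/orP; right.
  have : Q w < x * (v / 2 * sa).
    apply: lt_le_trans Qh _; apply: le_trans hle _.
    by rewrite ler_wpM2l ?(ltW x0)// ler_wpM2l// divr_ge0 ?ltW.
  rewrite /Q ltr_pM2l//; lra.
have b2 : (k%:R * (tau ^+ 2 * kap)) ^+ 2 <= sa ^+ 2.
  by apply: lerXn2r; rewrite ?nnegrE ?(ltW p0) ?(ltW sa0).
rewrite ler_pdivrMr ?exprn_gt0 ?mulr_gt0 ?divr_gt0//.
apply: le_trans (_ : m * (k%:R * (tau ^+ 2 * (b * kap)) ^+ 2) <= _).
  by rewrite ler_wpM2l.
apply: le_trans (_ : 4 * m * b ^+ 2 / (v ^+ 2 * k%:R) *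
   (v ^+ 2 / 4 * (k%:R * (tau ^+ 2 * kap)) ^+ 2) <= _).
  rewrite le_eqVlt; apply/orP; left; apply/eqP; field.
  by rewrite !gt_eqF.
apply: ler_wpM2l.
  have b0 := sqr_ge0 b; have v2 := sqr_ge0 v.
  by apply: divr_ge0; apply: mulr_ge0 => //; exact: mulr_ge0.
have -> : (v / 2 * sa) ^+ 2 = v ^+ 2 / 4 * sa ^+ 2 by field.
by rewrite ler_wpM2l// divr_ge0// sqr_ge0.
Qed.

Lemma pr_qsum0_tight (v m M : R) (N : nat) (A : set Omega) :
  0 <= m -> shift_norm2 (fun x : R => x ^+ 2 - v) m -> 0 < M -> measurable A ->
  (forall w, A w ->
     M <= `|qsum0 N w - v * (tau ^+ 2 * \sum_(1 <= j < N) K j)|) ->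
  pr A <= m * (tau ^+ 4 * \sum_(1 <= j < N) K j ^+ 2) / M ^+ 2.
Proof.
move=> m0 mE M0 mA hA.
have := @pr_sqr_ge v m M (fun j => tau ^+ 2 * K j) N A m0 mE M0 mA.
rewrite (_ : \sum_(1 <= j < N) (tau ^+ 2 * K j) ^+ 2 =
  tau ^+ 4 * \sum_(1 <= j < N) K j ^+ 2); last first.
  by rewrite mulr_sumr; apply: eq_bigr => j _; ring.
apply => w /hA; rewrite qsum0E; congr (_ <= `|_ - _ * _|).
by rewrite mulr_sumr.
Qed.

End truncated_statistic.

(** * Orders of magnitude of the weights and of the signal *)

Lemma near_powR_ge (R : realType) (s A : R) : 0 < s ->
  \forall n \near \oo, A <= n%:R `^ s.
Proof.
move=> s0; pose B := (`|A| + 1) `^ s^-1.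
near=> n.
have Bn : B <= n%:R.
  by near: n; exact: nbhs_infty_ger.
apply: (@le_trans _ _ (B `^ s)); last first.
  by apply: ge0_ler_powR; rewrite ?nnegrE ?powR_ge0// ltW.
rewrite -powRrM mulVf ?gt_eqF// powRr1; last by rewrite addr_ge0.
by have := ler_norm A; lra.
Unshelve. all: by end_near. Qed.

Lemma le_cvg_shift (R : realType) (f g : nat -> R) (a b e : R) (N0 : nat) :
  f @ \oo --> a -> g @ \oo --> b ->
  (forall N, (N0 <= N)%N -> f N <= g N + e) -> a <= b + e.
Proof.
move=> fa gb fg.
have gbe : (fun N => g N + e) @ \oo --> b + e by apply: cvgD => //; exact: cvg_cst.
rewrite -(cvg_lim _ fa)// -(cvg_lim _ gbe)//.
apply: ler_lim; [by apply/cvg_ex; exists a|by apply/cvg_ex; exists (b + e)|].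
by exists N0.
Qed.

(* Here [nn] stands for [n] and [z] for [n^{-2r}]; the remaining parameters are
   constants that do not depend on [n]. *)
Record regime (R : realType) (K theta : nat -> R) (k : nat) (nn z : R)
    (b g1 g2 g3 g4 G C : R) : Prop := Regime {
  regime_n : 0 < nn;
  regime_z : 0 < z;
  regime_k : (0 < k)%N;
  regime_K0 : forall j, 0 <= K j;
  regime_mono : forall i j, (0 < i <= j)%N -> K j <= K i;
  regime_kap : 0 < K k;
  regime_ub : forall j, (0 < j)%N -> K j <= b * K k;
  regime_sqr : forall N, nn ^+ 2 * \sum_(1 <= j < N) K j ^+ 2 <= G;
  regime_g1 : g1 <= nn ^+ 2 * (k%:R * K k ^+ 2);
  regime_g2 : nn ^+ 2 * (K k * z) <= g2;
  regime_g3 : g3 <= nn ^+ 2 * (K k * z);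
  regime_g4 : g4 * (nn * z) ^+ 2 <= k%:R;
  regime_theta : forall N, \sum_(1 <= j < N) theta j ^+ 2 <= C * z }.

Lemma nneseries_le_fin (R : realType) (u : nat -> R) (x : R) :
  (forall j, 0 <= u j) -> (forall N, \sum_(1 <= j < N) u j <= x) ->
  (\sum_(1 <= j <oo) (u j)%:E <= x%:E)%E.
Proof.
move=> u0 ux; apply: lime_le.
  by apply: is_cvg_nneseries => j _ _; rewrite lee_fin.
by near=> N; rewrite sumEFin lee_fin.
Unshelve. all: by end_near. Qed.

Lemma nneseries_ge_fin (R : realType) (u : nat -> R) (N : nat) :
  (forall j, 0 <= u j) ->
  ((\sum_(1 <= j < N) u j)%:E <= \sum_(1 <= j <oo) (u j)%:E)%E.
Proof.
move=> u0; rewrite -sumEFin; apply: nneseries_lim_ge => j _ _.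
by rewrite lee_fin.
Qed.

Lemma sum_nat_nondecreasing (R : realType) (u : nat -> R) (N N' : nat) :
  (forall j, 0 <= u j) -> (N <= N')%N ->
  \sum_(1 <= j < N) u j <= \sum_(1 <= j < N') u j.
Proof.
move=> u0; case: N => [|N] NN'; first by rewrite big_geq// sumr_ge0.
by rewrite (@big_cat_nat _ _ _ N.+1 1 N')//= lerDl sumr_ge0.
Qed.

(** Maximality of [k] forces the first [k] weights to sum to more than [rho / 2], while each is at
    most [b * K k]; this bounds [rho]. Bounding one factor of each square by [b * K k] gives the
    lower bound with [C1], and monotonicity puts [k * K k ^+ 2] below the sum of squares. *)
Lemma weights_orders (R : realType) (K : nat -> R) (rho q b C1 C2 : R) (k : nat) :
  (forall j, 0 <= K j) ->
  (fun N => \sum_(1 <= j < N) K j) @ \oo --> rho ->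
  (forall i : nat, \sum_(1 <= j < i) K j <= rho / 2 -> (i <= k)%N) ->
  (forall j, (1 <= j)%N -> K j.+1 <= K j) ->
  0 < q -> 0 < b -> 0 < rho -> 0 < C1 ->
  (C1%:E < q%:E * \sum_(1 <= j <oo) (K j ^+ 2)%:E)%E ->
  (q%:E * \sum_(1 <= j <oo) (K j ^+ 2)%:E < C2%:E)%E ->
  K 1%N <= b * K k ->
  [/\ (0 < k)%N /\ 0 < K k, forall i j, (0 < i <= j)%N -> K j <= K i,
      forall N, q * \sum_(1 <= j < N) K j ^+ 2 <= C2,
      rho <= 2 * b * (k%:R * K k) &
      C1 <= q * b * K k * rho /\ q * (k%:R * K k ^+ 2) <= C2].
Proof.
move=> K0 Krho ksup Kdec q0 b0 rho0 C10 hC1 hC2 K1.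
have k0 : (0 < k)%N by apply: ksup; rewrite big_geq// divr_ge0// ltW.
have mono i j : (0 < i <= j)%N -> K j <= K i.
  move=> /andP[i0 ij]; rewrite -(subnK ij); elim: (j - i)%N => [|l IH] //=.
  by apply: le_trans IH; rewrite addSn; apply: Kdec; rewrite addn_gt0 i0 orbT.
have ub j : (0 < j)%N -> K j <= b * K k.
  by move=> j0; apply: le_trans K1; exact: mono.
have Ksum N : \sum_(1 <= j < N) K j <= rho.
  rewrite -(cvg_lim _ Krho)//; apply: nondecreasing_cvgn_le.
    by move=> i j ij; exact: sum_nat_nondecreasing.
  by apply/cvg_ex; exists rho.
have sqr N : q * \sum_(1 <= j < N) K j ^+ 2 <= C2.
  rewrite -lee_fin EFinM; apply/ltW; apply: le_lt_trans hC2.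
  apply: lee_wpmul2l; first by rewrite lee_fin ltW.
  by apply: nneseries_ge_fin => j; exact: sqr_ge0.
have lo : C1 <= q * b * K k * rho.
  rewrite -lee_fin; apply/ltW/(lt_le_trans hC1).
  rewrite -!mulrA EFinM lee_pmul2l ?lte_fin//.
  apply: nneseries_le_fin => [j|N]; first exact: sqr_ge0.
  apply: (@le_trans _ _ (\sum_(1 <= j < N) (b * K k) * K j)).
    apply: ler_sum_nat => j /andP[j1 _]; rewrite expr2.
    by apply: ler_wpM2r => //; exact: ub.
  rewrite -mulr_sumr mulrA ler_wpM2l// mulr_ge0// ltW//.
have kap0 : 0 < K k.
  rewrite lt_neqAle K0 andbT eq_sym; apply/eqP => E; move: lo.
  by rewrite E mulr0 mul0r; lra.
split=> //.
- have : rho / 2 < \sum_(1 <= j < k.+1) K j.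
    by rewrite ltNge; apply/negP => /ksup; rewrite ltnn.
  have : \sum_(1 <= j < k.+1) K j <= k%:R * (b * K k).
    rewrite mulr_natl -[X in _ *+ X](subn1 k.+1) -sumr_const_nat.
    by apply: ler_sum_nat => j /andP[j1 _]; exact: ub.
  by move=> h1 h2; have := lt_le_trans h2 h1; lra.
- split=> //; apply: le_trans (sqr k.+1).
  apply: ler_wpM2l; first exact: ltW.
  rewrite mulr_natl -[X in _ *+ X](subn1 k.+1) -sumr_const_nat.
  apply: ler_sum_nat => j /andP[j1 jk].
  by apply: lerXn2r; rewrite ?nnegrE//; apply: mono; rewrite j1 -ltnS.
Qed.

(** Eliminating [rho] shows that [K k] is of exact order [1 / (nn^2 z)] and that [k] is at least of
    order [(nn z)^2]. *)
Lemma regime_of_orders (R : realType) (K theta : nat -> R)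
    (rho q nn z b c1 c2 C1 C2 C : R) (k : nat) :
  0 < nn -> 0 < z -> 0 < q -> 0 < b -> 0 < c1 -> 0 < c2 -> 0 < C1 ->
  c1 * z <= rho -> rho <= c2 * z ->
  (forall j, 0 <= K j) ->
  (forall N, \sum_(1 <= j < N) theta j ^+ 2 <= C * z) ->
  (forall j, (0 < j)%N -> K j <= b * K k) ->
  [/\ (0 < k)%N /\ 0 < K k, forall i j, (0 < i <= j)%N -> K j <= K i,
      forall N, q * nn ^+ 2 * \sum_(1 <= j < N) K j ^+ 2 <= C2,
      rho <= 2 * b * (k%:R * K k) &
      C1 <= q * nn ^+ 2 * b * K k * rho /\
      q * nn ^+ 2 * (k%:R * K k ^+ 2) <= C2] ->
  regime K theta k nn z b (C1 / (2 * b ^+ 2 * q)) (2 * b * C2 / (c1 * q))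
    (C1 / (b * c2 * q)) (c1 ^+ 2 * q / (4 * b ^+ 2 * C2)) (C2 / q) C.
Proof.
move=> n0 z0 q0 b0 c10 c20 C10 rho1 rho2 K0 th ub [[k0 kap0] mono sqr rk [lo hi]].
have n20 : 0 < nn ^+ 2 by rewrite exprn_gt0.
have k0R : 0 < k%:R :> R by rewrite ltr0n.
have C20 : 0 < C2.
  by apply: lt_le_trans hi; rewrite !mulr_gt0 ?exprn_gt0.
have g2 : nn ^+ 2 * (K k * z) <= 2 * b * C2 / (c1 * q).
  rewrite ler_pdivlMr ?mulr_gt0//.
  have h1 : c1 * z <= 2 * b * (k%:R * K k) by exact: le_trans rho1 rk.
  have h2 := ler_wpM2l (ltW (mulr_gt0 (mulr_gt0 q0 n20) kap0)) h1.
  have h3 := ler_wpM2l (ltW (mulr_gt0 (ltr0n _ 2) b0)) hi.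
  have E1 : nn ^+ 2 * (K k * z) * (c1 * q) = q * nn ^+ 2 * K k * (c1 * z) by ring.
  rewrite E1; apply: le_trans h2 _; apply: le_trans h3.
  by rewrite le_eqVlt; apply/orP; left; apply/eqP; ring.
split=> //.
- move=> N; rewrite ler_pdivlMr//; apply: le_trans (sqr N).
  by rewrite le_eqVlt; apply/orP; left; apply/eqP; ring.
- rewrite ler_pdivrMr ?mulr_gt0 ?exprn_gt0//.
  have h := ler_wpM2l (ltW (mulr_gt0 (mulr_gt0 (mulr_gt0 q0 n20) b0) kap0)) rk.
  apply: le_trans lo _; apply: le_trans h _.
  by rewrite le_eqVlt; apply/orP; left; apply/eqP; ring.
- rewrite ler_pdivrMr ?mulr_gt0//.
  have h := ler_wpM2l (ltW (mulr_gt0 (mulr_gt0 (mulr_gt0 q0 n20) b0) kap0)) rho2.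
  apply: le_trans lo _; apply: le_trans h _.
  by rewrite le_eqVlt; apply/orP; left; apply/eqP; ring.
(* Multiplying this bound by [nn^2 z] leaves [k] times [nn^2 K_k z], and the latter is at most
   [2 b C2 / (c1 q)]. *)
- have h1 : c1 * z <= 2 * b * (k%:R * K k) by exact: le_trans rho1 rk.
  have h2 := ler_wpM2l (_ : 0 <= (c1 * q / (2 * b * C2)) * (nn ^+ 2 * z)) h1.
  rewrite (_ : c1 ^+ 2 * q / (4 * b ^+ 2 * C2) * (nn * z) ^+ 2 =
    (2 * b)^-1 * (c1 * q / (2 * b * C2) * (nn ^+ 2 * z) * (c1 * z))); last first.
    by field; rewrite !gt_eqF.
  have cb : 0 < (2 * b)^-1 by rewrite invr_gt0 mulr_gt0.
  apply: le_trans (ler_wpM2l (ltW cb) (h2 _)) _.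
    by rewrite !mulr_ge0 ?invr_ge0 ?mulr_ge0 ?sqr_ge0// ltW.
  rewrite (_ : (2 * b)^-1 * _ =
    k%:R * (c1 * q / (2 * b * C2) * (nn ^+ 2 * (K k * z)))); last first.
    by field; rewrite !gt_eqF.
  apply: le_trans (_ : k%:R * (c1 * q / (2 * b * C2) * (2 * b * C2 / (c1 * q))) <= _).
    rewrite ler_wpM2l ?(ltW k0R)// ler_wpM2l//.
    by rewrite !mulr_ge0 ?invr_ge0 ?mulr_ge0// ltW.
  rewrite le_eqVlt; apply/orP; left; apply/eqP; field.
  by rewrite !gt_eqF.
Qed.

(** The Chebyshev bound for the linear term at scale [h / nn^2]: with weights at most [b * K k] and
    energy at most [C * z] it is [(nn^2 K_k z)^2] divided by [nn * z], up to constants, hence small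
    once [nn * z] is large. *)
Lemma regime_cross (R : realType) (K theta : nat -> R) (k N : nat) (nn z : R)
    (b g1 g2 g3 g4 G C m s h : R) :
  regime K theta k nn z b g1 g2 g3 g4 G C -> 0 <= m -> 0 < h -> 0 <= C ->
  m * (4 * (s ^+ 2 / nn) * \sum_(1 <= j < N) (K j * theta j) ^+ 2) /
    (h / nn ^+ 2) ^+ 2 <=
  4 * m * s ^+ 2 * b ^+ 2 * C * g2 ^+ 2 / (h ^+ 2 * (nn * z)).
Proof.
move=> reg m0 h0 C0.
have n0 := regime_n reg; have z0 := regime_z reg; have kap0 := regime_kap reg.
have sumle : \sum_(1 <= j < N) (K j * theta j) ^+ 2 <= (b * K k) ^+ 2 * (C * z).
  apply: (@le_trans _ _ (\sum_(1 <= j < N) (b * K k) ^+ 2 * theta j ^+ 2)).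
    apply: ler_sum_nat => j /andP[j1 _]; rewrite exprMn ler_wpM2r ?sqr_ge0//.
    have Kj := regime_ub reg j1; have Kj0 := regime_K0 reg j.
    by apply: lerXn2r; rewrite ?nnegrE// (le_trans Kj0).
  by rewrite -mulr_sumr ler_wpM2l ?sqr_ge0//; exact: regime_theta reg N.
have g20 : (nn ^+ 2 * (K k * z)) ^+ 2 <= g2 ^+ 2.
  have h1 : 0 <= nn ^+ 2 * (K k * z) by rewrite !mulr_ge0 ?sqr_ge0// ltW.
  have h2 := regime_g2 reg.
  by apply: lerXn2r; rewrite ?nnegrE// (le_trans h1).
apply: (@le_trans _ _ (m * (4 * (s ^+ 2 / nn) * ((b * K k) ^+ 2 * (C * z))) /
    (h / nn ^+ 2) ^+ 2)).
  rewrite ler_wpM2r ?invr_ge0 ?sqr_ge0// ler_wpM2l// ler_wpM2l//.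
  by rewrite mulr_ge0// divr_ge0 ?sqr_ge0// ltW.
rewrite (_ : m * _ / _ = 4 * m * s ^+ 2 * b ^+ 2 * C / (h ^+ 2 * (nn * z)) *
  (nn ^+ 2 * (K k * z)) ^+ 2); last by field; rewrite !gt_eqF.
rewrite [leRHS]mulrAC; apply: ler_wpM2l => //.
have hb := sqr_ge0 b; have hs := sqr_ge0 s; have hh := sqr_ge0 h.
apply: divr_ge0; last by rewrite mulr_ge0// mulr_ge0 ?ltW.
by apply: mulr_ge0 => //; apply: mulr_ge0 => //; apply: mulr_ge0 => //; exact: mulr_ge0.
Qed.

(** The sum is split at [c * k]: below it the weights are at most [b * K k] and the energy is small;
    beyond it the energy is only bounded by [C * z], but the weights are at most [L * K k]. *)
Lemma signal_le (R : realType) (K theta : nat -> R) (k N : nat) (nn z : R)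
    (b g1 g2 g3 g4 G C c L e : R) :
  regime K theta k nn z b g1 g2 g3 g4 G C ->
  1 < c -> 0 <= L -> 0 <= e -> 0 < b ->
  K (Num.truncn (c * k%:R)) <= L * K k ->
  \sum_(1 <= j < (Num.truncn (c * k%:R)).+1 | j%:R < c * k%:R) theta j ^+ 2
    <= e * z ->
  ((Num.truncn (c * k%:R)).+1 <= N)%N ->
  \sum_(1 <= j < N) K j * theta j ^+ 2 <= (b * e + L * C) * g2 / nn ^+ 2.
Proof.
move=> reg c1 L0 e0 b0 KL hd MN.
(* Every index [j < c * k] lies below [M], so the restricted sum over [j < M] misses none of
   them. *)
set M := (Num.truncn _).+1 in hd MN *.
have n0 := regime_n reg; have z0 := regime_z reg; have kap0 := regime_kap reg.
have k1 : 1 <= k%:R :> R by rewrite ler1n; exact: regime_k reg.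
have ck1 : 1 <= c * k%:R by nra.
have ck0 : 0 <= c * k%:R by lra.
have M1 : (0 < Num.truncn (c * k%:R))%N by rewrite truncn_gt0.
have step : \sum_(1 <= j < N) K j * theta j ^+ 2 <=
   \sum_(1 <= j < N) ((if (j%:R < c * k%:R) then b * K k * theta j ^+ 2 else 0) +
      L * K k * theta j ^+ 2).
  apply: ler_sum_nat => j /andP[j1 _].
  have t0 := sqr_ge0 (theta j).
  have Lt : 0 <= L * K k * theta j ^+ 2.
    by apply: mulr_ge0 => //; apply: mulr_ge0 => //; exact: ltW.
  case: ltP => jck.
    apply: le_trans (_ : b * K k * theta j ^+ 2 <= _); last by rewrite lerDl.
    by rewrite ler_wpM2r//; exact: regime_ub reg _ j1.
  rewrite add0r ler_wpM2r//; apply: le_trans KL; apply: regime_mono reg _ _ _.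
  by rewrite M1/= -(@ler_nat R); apply: le_trans jck; rewrite truncn_le.
apply: le_trans step _; rewrite big_split/= -mulr_sumr -big_mkcond -mulr_sumr/=.
have -> : \sum_(1 <= j < N | j%:R < c * k%:R) theta j ^+ 2 =
    \sum_(1 <= j < M | j%:R < c * k%:R) theta j ^+ 2.
  rewrite (@big_cat_nat _ _ _ M 1 N)//= [X in _ + X]big_nat_cond [X in _ + X]big1 ?addr0//.
  move=> j /andP[/andP[Mj _]]; rewrite ltNge.
  suff -> : c * k%:R <= j%:R by [].
  apply/ltW; apply: lt_le_trans (_ : M%:R <= _); first by rewrite truncnS_gt.
  by rewrite ler_nat.
have h1 := ler_wpM2l (ltW (mulr_gt0 b0 kap0)) hd.
have h2 := ler_wpM2l (mulr_ge0 L0 (ltW kap0)) (regime_theta reg N).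
apply: le_trans (lerD h1 h2) _.
have n20 : 0 < nn ^+ 2 by rewrite exprn_gt0.
have C0 : 0 <= C.
  have := regime_theta reg 1%N; rewrite big_geq// => Cz.
  by rewrite -(pmulr_lge0 _ z0).
rewrite ler_pdivlMr//.
have h3 := ler_wpM2l (addr_ge0 (mulr_ge0 (ltW b0) e0) (mulr_ge0 L0 C0)) (regime_g2 reg).
apply: le_trans h3; rewrite le_eqVlt; apply/orP; left; apply/eqP; ring.
Qed.

(** By monotonicity every index below [c' * k] has weight at least [L * K k]. Two constants appear
    because the weight bound is available only for factors above 1, whereas [c'] may be any positive
    number. *)
Lemma signal_ge (R : realType) (K theta : nat -> R) (k N : nat) (nn z : R)
    (b g1 g2 g3 g4 G C c c' L e : R) :
  regime K theta k nn z b g1 g2 g3 g4 G C ->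
  0 < c' -> c' <= c -> 0 < L -> 0 <= e ->
  L * K k <= K (Num.truncn (c * k%:R)) ->
  e * z <=
    \sum_(1 <= j < (Num.truncn (c' * k%:R)).+1 | j%:R < c' * k%:R) theta j ^+ 2 ->
  ((Num.truncn (c' * k%:R)).+1 <= N)%N ->
  L * e * g3 / nn ^+ 2 <= \sum_(1 <= j < N) K j * theta j ^+ 2.
Proof.
move=> reg c0 cc L0 e0 KL hd MN.
set M := (Num.truncn _).+1 in hd MN *.
have n0 := regime_n reg; have z0 := regime_z reg; have kap0 := regime_kap reg.
have n20 : 0 < nn ^+ 2 by rewrite exprn_gt0.
have k0 : 0 <= k%:R :> R by [].
apply: (@le_trans _ _ (L * K k * (e * z))).
  rewrite ler_pdivrMr//.
  have h3 := ler_wpM2l (mulr_ge0 (ltW L0) e0) (regime_g3 reg).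
  apply: le_trans h3 _; rewrite le_eqVlt; apply/orP; left; apply/eqP; ring.
apply: le_trans (ler_wpM2l (ltW (mulr_gt0 L0 kap0)) hd) _.
have tK j : 0 <= K j * theta j ^+ 2.
  by rewrite mulr_ge0 ?sqr_ge0//; exact: regime_K0 reg j.
apply: le_trans (sum_nat_nondecreasing tK MN).
rewrite mulr_sumr big_mkcond; apply: ler_sum_nat => j /andP[j1 _].
case: ltP => jck //; rewrite ler_wpM2r ?sqr_ge0//.
apply: le_trans KL _; apply: regime_mono reg _ _ _; rewrite j1/=.
rewrite truncn_ge_nat; first by apply/ltW/(lt_le_trans jck); rewrite ler_wpM2r.
by rewrite mulr_ge0//; lra.
Qed.

(** * Rejection probabilities of the full statistic *)

(** The total drop telescopes over [m] steps of length [h], so one step loses at least the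
    average. *)
Lemma pigeonhole_drop (R : realType) (q : R -> R) (L h a : R) (m : nat) :
  (0 < m)%N -> a <= q L - q (L + m%:R * h) ->
  exists t, a / m%:R <= q (t - h) - q t.
Proof.
move=> m0 dq; apply: contrapT => nex.
have lt i : q (L + i%:R * h) - q (L + i.+1%:R * h) < a / m%:R.
  rewrite ltNge; apply/negP => le; apply: nex; exists (L + i.+1%:R * h).
  by rewrite (_ : L + i.+1%:R * h - h = L + i%:R * h)// -natr1; ring.
have tel l : (0 < l)%N -> q L - q (L + l%:R * h) < l%:R * (a / m%:R).
  elim: l => // -[_ _|l IH _].
    by have := lt 0%N; rewrite mul0r addr0 !mul1r.
  have := lt l.+1; have := IH isT; rewrite -[l.+2%:R]natr1.
  set x := q (L + _); set y := q (L + _); set e := a / _; nra.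
have := tel m m0; rewrite mulrCA mulfV ?mulr1 ?pnatr_eq0 -?lt0n//.
by move=> /(le_lt_trans dq); rewrite ltxx.
Qed.

Section rejection.
Context (d : measure_display) (Omega : measurableType d) (R : realType).
Context (P : probability Omega R) (xi : nat -> {RV P >-> R}).
Hypothesis iid : iid_std_normal xi.
Variables (sigma : R) (n : nat) (K : nat -> R) (rho : R).
Hypothesis K0 : forall j, 0 <= K j.
Hypothesis sigma0 : 0 < sigma.
Hypothesis n0 : (0 < n)%N.

Local Notation tau := (sigma / Num.sqrt n%:R).
Local Notation shift := (sigma ^+ 2 / n%:R * rho).

Definition rej (theta : nat -> R) (t : R) : R :=
  pr P [set w | (t%:E < Tstat xi sigma n K rho theta w)%E].

Lemma measurable_obs_term theta j : measurable_fun setT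
  (fun w => K j * obs xi sigma n theta j w ^+ 2).
Proof.
apply: measurable_funM => //; apply: measurable_funX.
by apply: measurable_funD => //; exact: measurable_funM.
Qed.

Lemma rej_cvg theta t :
  (fun N => pr P [set w | t + shift < qsum xi K tau theta N w]) @ \oo -->
  rej theta t.
Proof.
apply: (@pr_series_cvg _ _ _ P (fun j w => K j * obs xi sigma n theta j w ^+ 2)).
  by move=> j; exact: measurable_obs_term.
by move=> j w; rewrite mulr_ge0// sqr_ge0.
Qed.

Lemma measurable_rej theta t :
  measurable [set w | (t%:E < Tstat xi sigma n K rho theta w)%E].
Proof.
apply: (@measurable_series_gt _ _ _
  (fun j w => K j * obs xi sigma n theta j w ^+ 2)).
  by move=> j; exact: measurable_obs_term.
by move=> j w; rewrite mulr_ge0// sqr_ge0.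
Qed.

Lemma err_sumE theta t :
  (alpha_err xi sigma n K rho t + beta_err xi sigma n K rho t theta)%E =
  (1 + rej (fun=> 0) t - rej theta t)%:E.
Proof.
rewrite /alpha_err /beta_err prE; last exact: measurable_rej.
rewrite -[X in P X]/(~` [set w | (t%:E < Tstat xi sigma n K rho theta w)%E]).
rewrite prE; last by apply: measurableC; exact: measurable_rej.
rewrite pr_setC; last exact: measurable_rej.
by rewrite -EFinD; congr EFin; rewrite /rej; ring.
Qed.

Lemma tau_sqr : tau ^+ 2 = sigma ^+ 2 / n%:R.
Proof. by rewrite expr_div_n sqr_sqrtr. Qed.

Lemma tau_gt0 : 0 < tau.
Proof. by rewrite divr_gt0// sqrtr_gt0 ltr0n. Qed.

Variables (theta : nat -> R) (k : nat) (z b g1 g2 g3 g4 G C : R).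
Hypothesis reg : regime K theta k n%:R z b g1 g2 g3 g4 G C.
Hypothesis C0 : 0 <= C.

(** The three error terms are the cost of inflating variances, the failure probability for the first
    [k] squares, and the linear term. The bound holds for all truncations beyond [N0] and [k] with
    errors free of [N], so it survives the limit. *)
Lemma rej_upper (v m m' eta t : R) (N0 : nat) :
  0 < v -> 0 <= m -> shift_norm2 (fun x : R => x ^+ 2 - v) m ->
  0 <= m' -> shift_norm2 (fun x : R => x) m' ->
  0 < eta -> eta ^+ 2 <= 2^-1 -> 0 < g1 -> 0 < g4 ->
  let h := eta * (v / 2) * sigma ^+ 2 * Num.sqrt g1 in
  (forall N, (N0 <= N)%N ->
     \sum_(1 <= j < N) K j * theta j ^+ 2 <= h / 2 / n%:R ^+ 2) ->
  rej theta t <= rej (fun=> 0) t + (3 / 2 * eta +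
    4 * m * b ^+ 2 / (v ^+ 2 * (g4 * (n%:R * z) ^+ 2)) +
    4 * m' * sigma ^+ 2 * b ^+ 2 * C * g2 ^+ 2 / ((h / 2) ^+ 2 * (n%:R * z))).
Proof.
move=> v0 m0 mE m'0 m'E e0 e2 g10 g40 h mu.
have nR := regime_n reg; have z0 := regime_z reg; have kap0 := regime_kap reg.
have k0 := regime_k reg; have k0R : 0 < k%:R :> R by rewrite ltr0n.
have n2 : 0 < n%:R ^+ 2 :> R by rewrite exprn_gt0.
have h0 : 0 < h.
  by rewrite /h !mulr_gt0 ?invr_gt0 ?exprn_gt0 ?sqrtr_gt0.
pose h' := h / n%:R ^+ 2.
have h'0 : 0 < h' by rewrite divr_gt0.
(* After cancellation this amounts to [sqrt g1 <= n * sqrt k * K k], the square root of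
   [regime_g1]. *)
have hle : h' <= eta / Num.sqrt k%:R * (v / 2 * (k%:R * (tau ^+ 2 * K k))).
  rewrite tau_sqr.
  have sk : 0 < Num.sqrt k%:R :> R by rewrite sqrtr_gt0.
  have kE : k%:R = Num.sqrt k%:R * Num.sqrt k%:R :> R.
    by rewrite -expr2 sqr_sqrtr// ltW.
  have E : eta / Num.sqrt k%:R * (v / 2 * (k%:R * (sigma ^+ 2 / n%:R * K k))) =
      eta * (v / 2) * sigma ^+ 2 / n%:R * (Num.sqrt k%:R * K k).
    by rewrite {2}kE; field; rewrite !gt_eqF.
  rewrite E /h'.
  have le1 : Num.sqrt g1 <= n%:R * (Num.sqrt k%:R * K k).
    have p0 : 0 <= n%:R * (Num.sqrt k%:R * K k) by rewrite !mulr_ge0 ?ltW.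
    rewrite -[leRHS]ger0_norm// -sqrtr_sqr.
    apply: ler_wsqrtr; apply: le_trans (regime_g1 reg) _.
    by rewrite !exprMn sqr_sqrtr// ltW.
  have A0 : 0 <= eta * (v / 2) * sigma ^+ 2 by rewrite !mulr_ge0 ?invr_ge0 ?ltW.
  rewrite ler_pdivrMr//; apply: le_trans (ler_wpM2l A0 le1) _.
  by rewrite le_eqVlt; apply/orP; left; apply/eqP; field; rewrite gt_eqF.
have F1 := @rej_cvg theta t; have F2 := @rej_cvg (fun=> 0) t.
have := @le_cvg_shift R _ _ _ _ _ (maxn N0 k.+1) F1 F2.
apply => N.
rewrite geq_max => /andP[NN kN].
have muN : \sum_(1 <= j < N) K j * theta j ^+ 2 <= h' / 2.
  by apply: le_trans (mu N NN) _; rewrite /h' mulrAC.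
apply: le_trans (@pr_qsum_le _ _ _ _ _ iid K tau m' _ h' theta N m'0 m'E h'0 muN) _.
have := @pr_qsum0_anticoncentration _ _ _ _ _ iid K tau v m b (K k) eta (t + shift)
  h' k N v0 m0 mE _ e0 e2 tau_gt0 kap0 _ hle.
rewrite k0 kN => /(_ isT) H.
apply: le_trans (lerD (H _) (lexx _)) _.
  move=> j /andP[j0 jk]; split; first by apply: regime_mono reg _ _ _; rewrite j0.
  exact: regime_ub reg _ j0.
rewrite -!addrA lerD2l lerD2l; apply: lerD.
  apply: ler_wpM2l; first by apply: mulr_ge0; [exact: mulr_ge0|exact: sqr_ge0].
  rewrite lef_pV2 ?posrE ?mulr_gt0 ?exprn_gt0 ?mulr_gt0//.
  by rewrite ler_pM2l ?exprn_gt0//; exact: regime_g4 reg.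
rewrite tau_sqr (_ : h' / 2 = h / 2 / n%:R ^+ 2); last by rewrite /h' mulrAC.
by apply: (@regime_cross R K theta k N n%:R z b g1 g2 g3 g4 G) => //; rewrite divr_gt0.
Qed.

Lemma rej_lower (m' h t : R) (N0 : nat) :
  0 <= m' -> shift_norm2 (fun x : R => x) m' -> 0 < h ->
  (forall N, (N0 <= N)%N ->
     2 * (h / n%:R ^+ 2) <= \sum_(1 <= j < N) K j * theta j ^+ 2) ->
  rej (fun=> 0) (t - h / n%:R ^+ 2) <= rej theta t +
    4 * m' * sigma ^+ 2 * b ^+ 2 * C * g2 ^+ 2 / (h ^+ 2 * (n%:R * z)).
Proof.
move=> m'0 m'E h0 mu.
have nR := regime_n reg.
have h'0 : 0 < h / n%:R ^+ 2 by rewrite divr_gt0// exprn_gt0.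
have := @le_cvg_shift R _ _ _ _ _ N0 (@rej_cvg (fun=> 0) (t - h / n%:R ^+ 2))
  (@rej_cvg theta t).
apply => N NN.
rewrite addrAC; apply: le_trans (@pr_qsum_ge _ _ _ _ _ iid K tau m' _ _ theta N m'0 m'E h'0
  (mu N NN)) _.
by rewrite lerD2l tau_sqr; exact: (@regime_cross R K theta k N n%:R z b g1 g2 g3 g4 G).
Qed.

(** Chebyshev around [ctr], the null mean of the statistic. The offset is twice [M / n^2] to leave
    room for replacing the mean of a truncated sum by its limit. *)
Lemma rej_null_tight (v m M : R) :
  (fun N => \sum_(1 <= j < N) K j) @ \oo --> rho ->
  0 < v -> 0 <= m -> shift_norm2 (fun x : R => x ^+ 2 - v) m -> 0 < M ->
  let ctr := v * shift - shift in
  let e := m * sigma ^+ 4 * G / M ^+ 2 in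
  rej (fun=> 0) (ctr + 2 * (M / n%:R ^+ 2)) <= e /\
  1 - e <= rej (fun=> 0) (ctr - 2 * (M / n%:R ^+ 2)).
Proof.
move=> Krho v0 m0 mE M0 ctr e.
have nR := regime_n reg.
have n2 : 0 < n%:R ^+ 2 :> R by rewrite exprn_gt0.
have M'0 : 0 < M / n%:R ^+ 2 by rewrite divr_gt0.
have bd N : m * (tau ^+ 4 * \sum_(1 <= j < N) K j ^+ 2) / (M / n%:R ^+ 2) ^+ 2 <= e.
  rewrite (exprM tau 2 2) tau_sqr.
  rewrite (_ : m * _ / _ = m * sigma ^+ 4 / M ^+ 2 *
    (n%:R ^+ 2 * \sum_(1 <= j < N) K j ^+ 2)); last by field; rewrite !gt_eqF.
  rewrite /e [leRHS]mulrAC; apply: ler_wpM2l; last exact: regime_sqr reg N.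
  by rewrite divr_ge0 ?sqr_ge0// mulr_ge0// (exprM sigma 2 2) sqr_ge0.
have Ksum N : \sum_(1 <= j < N) K j <= rho.
  rewrite -(cvg_lim _ Krho)//; apply: nondecreasing_cvgn_le.
    by move=> i j ij; exact: sum_nat_nondecreasing.
  by apply/cvg_ex; exists rho.
have s0 : 0 < v * (sigma ^+ 2 / n%:R) by rewrite mulr_gt0// divr_gt0// exprn_gt0.
have mq c N : measurable [set w | c < qsum xi K tau (fun=> 0) N w].
  by apply: measurable_gt; exact: measurable_qsum.
split.
  rewrite -[leRHS]add0r.
  apply: (@le_cvg_shift R _ (fun=> 0) _ _ _ 0%N (@rej_cvg _ _) (@cvg_cst _ _ _ _ _)) => N _.
  rewrite add0r; apply: le_trans (bd N).
  apply: (@pr_qsum0_tight _ _ _ _ _ iid K tau v m _ N _ m0 mE M'0 (mq _ _)) => w /= h.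
  rewrite tau_sqr; apply: le_trans (ler_norm _).
  have := ler_wpM2l (ltW s0) (Ksum N); rewrite /ctr in h; lra.
rewrite lerBlDr.
(* Beyond [N1] the omitted weights change the mean by at most [M / n^2]. *)
have [N1 _ hN1] : \forall N \near \oo,
    rho - M / n%:R ^+ 2 / (v * (sigma ^+ 2 / n%:R)) <= \sum_(1 <= j < N) K j.
  have p0 : 0 < M / n%:R ^+ 2 / (v * (sigma ^+ 2 / n%:R)) by rewrite divr_gt0.
  have /cvgrPdist_le/(_ _ p0)[N1 _ hN] := Krho; exists N1 => // N NN.
  by have := hN N NN; move=> /ler_normlP[_]; rewrite lerBlDr -lerBlDl lerBlDr addrC -lerBlDr.
apply: (@le_cvg_shift R (fun=> 1) _ _ _ _ N1 (@cvg_cst _ _ _ _ _) (@rej_cvg _ _)) => N NN.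
have := bd N; set A := [set w | _ < _].
have mA : measurable A by exact: mq.
have : pr P (~` A) <= m * (tau ^+ 4 * \sum_(1 <= j < N) K j ^+ 2) /
    (M / n%:R ^+ 2) ^+ 2.
  apply: (@pr_qsum0_tight _ _ _ _ _ iid K tau v m _ N _ m0 mE M'0 (measurableC mA)).
  move=> w /= /negP.
  rewrite -leNgt => h; rewrite tau_sqr -normrN; apply: le_trans (ler_norm _).
  have := ler_wpM2l (ltW s0) (hN1 N NN).
  rewrite mulrBr [X in _ - X <= _]mulrC divfK ?gt_eqF//; rewrite /ctr in h; lra.
by rewrite pr_setC//; lra.
Qed.

End rejection.

(** * The two implications, with constants uniform in [n] *)

Theorem theorem4 (R : realType) (d : measure_display) (Omega : measurableType d)
  (P : probability Omega R) (xi : nat -> {RV P >-> R})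
  (sigma r : R) (kappa2 : nat -> nat -> R) (rho : nat -> R) (kn : nat -> nat)
  (theta : nat -> nat -> R) :
  iid_std_normal xi ->
  0 < sigma -> 0 < r -> r < 2^-1 ->
  (* nonnegative weights, rho_n = sum_{j>=1} kappa_{nj}^2 < oo *)
  (forall n j, 0 <= kappa2 n j) ->
  (forall n, (0 < n)%N ->
     (fun N => \sum_(1 <= j < N) kappa2 n j) @ \oo --> rho n) ->
  (* k_n = sup {k : sum_{j<k} kappa_{nj}^2 <= rho_n / 2} *)
  (forall n, (0 < n)%N ->
     \sum_(1 <= j < kn n) kappa2 n j <= rho n / 2 /\
     forall k : nat, \sum_(1 <= j < k) kappa2 n j <= rho n / 2 -> (k <= kn n)%N) ->
  (* (A1) *)
  (forall n j, (0 < n)%N -> (1 <= j)%N -> kappa2 n j.+1 <= kappa2 n j) ->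
  (* (A2) *)
  (exists C1 C2 : R, 0 < C1 /\ 0 < C2 /\ forall n, (0 < n)%N ->
     (C1%:E < (sigma ^- 4 * n%:R ^+ 2)%:E * \sum_(1 <= j <oo) (kappa2 n j ^+ 2)%:E)%E /\
     ((sigma ^- 4 * n%:R ^+ 2)%:E * \sum_(1 <= j <oo) (kappa2 n j ^+ 2)%:E < C2%:E)%E) ->
  (* (A3) *)
  (exists c1 c2 : R, 0 < c1 /\ 0 < c2 /\ forall n, (0 < n)%N ->
     c1 * n%:R `^ (- (2 * r)) <= rho n /\ rho n <= c2 * n%:R `^ (- (2 * r))) ->
  (* (A4) *)
  (exists C1 lambda : R, 0 < C1 /\ 1 < lambda /\ forall (delta : R) n, 0 < delta -> (0 < n)%N ->
     kappa2 n (Num.truncn ((1 + delta) * (kn n)%:R))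
       < C1 * (1 + delta) `^ (- lambda) * kappa2 n (kn n)) ->
  (* (A5) *)
  (exists a b : R, 0 < a /\ 0 < b /\ forall n, (0 < n)%N ->
     a * kappa2 n (kn n) <= kappa2 n 1 /\ kappa2 n 1 <= b * kappa2 n (kn n)) ->
  (forall c : R, 1 < c -> exists C : R, 0 < C /\ forall n, (0 < n)%N ->
     C * kappa2 n (kn n) <= kappa2 n (Num.truncn (c * (kn n)%:R))) ->
  (* c n^{-r} <= ||f_n|| <= C n^{-r}, with ||f_n||^2 = sum_{j>=1} theta_{nj}^2 *)
  (exists c C : R, 0 < c /\ c < C /\ forall n, (0 < n)%N ->
     (((c * n%:R `^ (- r)) ^+ 2)%:E <= \sum_(1 <= j <oo) (theta n j ^+ 2)%:E)%E /\
     (\sum_(1 <= j <oo) (theta n j ^+ 2)%:E <= ((C * n%:R `^ (- r)) ^+ 2)%:E)%E) ->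
  inconsistent xi sigma kappa2 rho theta <->
  (forall c2 : R, 0 < c2 ->
     (fun n => \sum_(1 <= j < (Num.truncn (c2 * (kn n)%:R)).+1 | (j%:R < c2 * (kn n)%:R))
                  theta n j ^+ 2)
       =o_\oo (fun n => n%:R `^ (- (2 * r)))).
Proof.
move=> iid s0 r0 r12 K0 Krho kdef A1 [C1 [C2 [C10 [C20 A2]]]]
  [c1 [c2 [c10 [c20 A3]]]] [D1 [lam [D10 [lam1 A4]]]] [a [b [_ [b0 A5]]]] A5'
  [ct [Ct [ct0 [ctCt th]]]].
pose z (n : nat) : R := n%:R `^ (- (2 * r)).
pose q : R := sigma ^- 4.
have q0 : 0 < q by rewrite invr_gt0 exprn_gt0.
pose g1 := C1 / (2 * b ^+ 2 * q); pose g2 := 2 * b * C2 / (c1 * q).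
pose g3 := C1 / (b * c2 * q); pose g4 := c1 ^+ 2 * q / (4 * b ^+ 2 * C2).
pose G := C2 / q; pose C := Ct ^+ 2.
have b20 : 0 < b ^+ 2 by rewrite exprn_gt0.
have g10 : 0 < g1 by rewrite divr_gt0// mulr_gt0// mulr_gt0.
have g20 : 0 < g2 by rewrite divr_gt0// mulr_gt0// mulr_gt0.
have g30 : 0 < g3 by rewrite divr_gt0// mulr_gt0// mulr_gt0.
have g40 : 0 < g4.
  by rewrite divr_gt0// mulr_gt0// ?exprn_gt0// mulr_gt0.
have G0 : 0 < G by rewrite divr_gt0.
have C0 : 0 < C by rewrite exprn_gt0// (lt_trans ct0).
have z0 n : (0 < n)%N -> 0 < z n by move=> n0; apply: powR_gt0; rewrite ltr0n.
have reg n : (0 < n)%N ->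
    regime (kappa2 n) (theta n) (kn n) n%:R (z n) b g1 g2 g3 g4 G C.
  move=> n0; have nR : 0 < n%:R :> R by rewrite ltr0n.
  have [rho1 rho2] := A3 n n0; have [_ ksup] := kdef n n0.
  have [lo hi] := A2 n n0; have [_ Kub] := A5 n n0.
  have qn0 : 0 < q * n%:R ^+ 2 by rewrite mulr_gt0// exprn_gt0.
  have rho0 : 0 < rho n by apply: lt_le_trans rho1; rewrite mulr_gt0//; exact: z0.
  have ord := weights_orders (K0 n) (Krho n n0) ksup (fun j => A1 n j n0) qn0 b0
    rho0 C10 lo hi Kub.
  apply: (regime_of_orders _ _ _ _ _ _ _ rho1 rho2 (K0 n) _ _ ord) => //.
    exact: z0.
    move=> N; rewrite -lee_fin; apply: le_trans (nneseries_ge_fin N _) _.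
      by move=> j; exact: sqr_ge0.
    have [_] := th n n0; rewrite exprMn; congr (_ <= (_ * _)%:E)%E.
    rewrite -powR_mulrn ?powR_ge0// -powRrM /z; congr (_ `^ _); ring.
  move=> j j0; apply: le_trans Kub; have [_ mono _ _ _] := ord.
  by apply: mono; rewrite j0.
(* Since [n * z n = n^(1 - 2r)], the condition [r < 1/2] makes it diverge, and all error terms in
   powers of its inverse vanish. *)
have bigX A : \forall n \near \oo, A <= n%:R * z n.
  have s : 0 < 1 - 2 * r by lra.
  near=> n.
  have n0 : (0 < n)%N by near: n; exists 1%N.
  rewrite (_ : n%:R * z n = n%:R `^ (1 - 2 * r)); first by near: n; exact: near_powR_ge.
  rewrite powRD; last by rewrite pnatr_eq0 -lt0n n0 implybT.
  by rewrite powRr1.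
have [m' m'0 m'E] := normal_shift_norm2_id R.
have [v [v0 [m m0 mE]]] := normal_shift_norm2_sqr R.
split.
- move=> inc c c0; apply/eqoP => eps eps0.
  (* [c] may be at most 1, so (A5) is applied at [c + 1] and monotonicity of the weights covers
     indices below [c * k_n]. *)
  have [L [L0 A5L]] := A5' (c + 1) ltac:(lra).
  (* Low-frequency energy above [eps * z n] makes the signal at least [2 * h0 / n^2], by
     [signal_ge]. *)
  pose h0 := L * eps * g3 / 2.
  have h00 : 0 < h0 by rewrite divr_gt0// mulr_gt0// mulr_gt0.
  (* Makes the Chebyshev error at most 1/4 on each side, so the null rejection probability drops by
     at least 1/2 over a window of length [4 M / n^2]. *)
  pose M := 4 * (m * sigma ^+ 4 * G) + 1.
  have mG0 : 0 <= m * sigma ^+ 4 * G.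
    by rewrite mulr_ge0 ?(ltW G0)// mulr_ge0// ltW// exprn_gt0.
  have M1 : 1 <= M by rewrite /M; lra.
  have M0 : 0 < M by lra.
  have eM : m * sigma ^+ 4 * G / M ^+ 2 <= 4^-1.
    rewrite ler_pdivrMr ?exprn_gt0// expr2.
    have : M <= M * M by rewrite ler_peMl// ltW.
    by move: mG0; rewrite /M; set x := m * sigma ^+ 4 * G; lra.
  (* The window is cut into [mc] steps of length [h / n^2] with [h <= h0]; one of them carries a
     drop of at least [dl = 1 / (2 mc)]. *)
  pose mc := (Num.truncn (4 * M / h0)).+1.
  have mc0 : 0 < mc%:R :> R by rewrite ltr0n.
  pose h := 4 * M / mc%:R.
  have hh0 : h <= h0.
    rewrite ler_pdivrMr// [leRHS]mulrC -ler_pdivrMr//; apply/ltW.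
    exact: truncnS_gt.
  have hpos : 0 < h by rewrite divr_gt0// mulr_gt0.
  pose dl := (2 * mc%:R)^-1 : R.
  have dl0 : 0 < dl by rewrite invr_gt0 mulr_gt0.
  pose T := 4 * m' * sigma ^+ 2 * b ^+ 2 * C * g2 ^+ 2 / h ^+ 2.
  pose f n := \sum_(1 <= j < (Num.truncn (c * (kn n)%:R)).+1
                   | (j%:R < c * (kn n)%:R)) theta n j ^+ 2.
  (* A threshold is chosen for every [n], arbitrarily where the premises fail. A single sequence [t]
     then contradicts inconsistency at every large [n] with too much energy, without extracting a
     subsequence. *)
  have ex n : exists t, (0 < n)%N -> 2 * T / dl <= n%:R * z n ->
      eps * z n < f n ->
      1 + rej xi sigma n (kappa2 n) (rho n) (fun=> 0) t -
        rej xi sigma n (kappa2 n) (rho n) (theta n) t <= 1 - dl / 2.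
    have [n0|n0] := posnP n; first by exists 0; rewrite n0.
    have nR : 0 < n%:R :> R by rewrite ltr0n.
    have n2 : 0 < n%:R ^+ 2 :> R by rewrite exprn_gt0.
    have [Xn|Xn] := leP (2 * T / dl) (n%:R * z n); last first.
      by exists 0.
    have [fn|fn] := leP (f n) (eps * z n).
      by exists 0.
    have X0 : 0 < n%:R * z n by rewrite mulr_gt0//; exact: z0.
    pose q0' := rej xi sigma n (kappa2 n) (rho n) (fun=> 0).
    have [up dn] := rej_null_tight iid (K0 n) s0 (reg n n0) (Krho n n0) v0 m0 mE M0.
    set ctr := v * _ - _ in up dn.
    have drop : 2^-1 <= q0' (ctr - 2 * (M / n%:R ^+ 2)) -
        q0' (ctr - 2 * (M / n%:R ^+ 2) + mc%:R * (h / n%:R ^+ 2)).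
      have -> : ctr - 2 * (M / n%:R ^+ 2) + mc%:R * (h / n%:R ^+ 2) =
          ctr + 2 * (M / n%:R ^+ 2).
        by rewrite /h; field; rewrite !gt_eqF.
      by rewrite /q0'; lra.
    have [t ht] := pigeonhole_drop (ltn0Sn _) drop.
    exists t => _ _ _.
    have low : q0' (t - h / n%:R ^+ 2) <=
        rej xi sigma n (kappa2 n) (rho n) (theta n) t + T / (n%:R * z n).
      rewrite /T -mulrA -invfM.
      apply: (rej_lower iid sigma (rho n) (K0 n) (reg n n0) (ltW C0) t
        (N0 := (Num.truncn (c * (kn n)%:R)).+1) m'0 m'E hpos) => N NN.
      apply: le_trans (signal_ge (reg n n0) c0 _ L0 (ltW eps0) (A5L n n0)
        (ltW fn) NN); last by lra.
      rewrite mulrA ler_pM2r ?invr_gt0//.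
      by have := hh0; rewrite /h0; lra.
    have Tle : T / (n%:R * z n) <= dl / 2.
      rewrite ler_pdivrMr// mulrC -ler_pdivrMr ?divr_gt0//.
      by rewrite invf_div mulrA [T * 2]mulrC.
    have dlE : dl = 2^-1 / mc%:R by rewrite /dl invfM.
    by move: ht; rewrite -dlE -/q0' => ht; lra.
  have [t ht] := choice ex.
  have near_err := limn_einf_gt (inc t) (divr_gt0 dl0 (ltr0n _ 2)).
  near=> n.
  have n0 : (0 < n)%N by near: n; exists 1%N.
  have Xn : 2 * T / dl <= n%:R * z n by near: n; exact: bigX.
  have : ((1 - dl / 2)%:E < alpha_err xi sigma n (kappa2 n) (rho n) (t n) +
      beta_err xi sigma n (kappa2 n) (rho n) (t n) (theta n))%E.
    by near: n; exact: near_err.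
  rewrite err_sumE// lte_fin => err.
  rewrite -/(f n) -/(z n) ger0_norm; last by apply: sumr_ge0 => j _; exact: sqr_ge0.
  rewrite gtr0_norm; last exact: z0.
  rewrite leNgt; apply/negP => fn.
  by have := lt_le_trans err (ht n n0 Xn fn); rewrite ltxx.
- move=> small t; apply: ge_limn_einf => e e0.
  (* The bound [e / 6] keeps [3 / 2 * eta] below [e / 4]; the bound 1/2 ensures [eta^2 <= 1/2]. *)
  pose eta := Num.min 2^-1 (e / 6).
  have eta0 : 0 < eta by rewrite lt_min invr_gt0 ltr0n divr_gt0.
  have eta1 : eta <= 2^-1 by rewrite ge_min lexx.
  have eta2 : eta <= e / 6 by rewrite ge_min lexx orbT.
  have eta_sqr : eta ^+ 2 <= 2^-1 by rewrite expr2; nra.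
  pose h := eta * (v / 2) * sigma ^+ 2 * Num.sqrt g1.
  have h0 : 0 < h.
    by rewrite /h mulr_gt0 ?sqrtr_gt0// mulr_gt0 ?exprn_gt0// mulr_gt0// divr_gt0.
  (* This is [delta] in (A4). As [lam > 1], [c^(- lam) <= 1 / c <= 1 / dl], so the high frequencies
     contribute at most [h / 4] to the signal, in units of [n^(-2)]. *)
  pose dl := 4 * D1 * C * g2 / h.
  have dl0 : 0 < dl by rewrite divr_gt0// mulr_gt0// mulr_gt0// mulr_gt0.
  pose c := 1 + dl.
  pose L := D1 * c `^ (- lam).
  have c0 : 0 < c by rewrite /c; lra.
  have L0 : 0 <= L by rewrite mulr_ge0 ?powR_ge0// ltW.
  have LC : L * C * g2 <= h / 4.
    have cl : c `^ (- lam) <= dl^-1.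
      apply: (@le_trans _ _ (c `^ (- 1))).
        by apply: ler_powR; rewrite /c; lra.
      rewrite powR_inv1; last exact: ltW.
      by rewrite lef_pV2 ?posrE// /c; lra.
    have p0 : 0 <= D1 * C * g2 by apply/ltW; rewrite mulr_gt0// mulr_gt0.
    have := ler_wpM2l p0 cl.
    have -> : D1 * C * g2 * dl^-1 = h / 4.
      by rewrite /dl; field; rewrite !gt_eqF.
    by apply: le_trans; rewrite /L le_eqVlt; apply/orP; left; apply/eqP; ring.
  (* The low frequencies contribute the other [h / 4], which completes the bound [h / 2] required by
     [rej_upper]. *)
  pose eps := h / (4 * b * g2).
  have eps0 : 0 < eps by rewrite divr_gt0// mulr_gt0// mulr_gt0.
  have beps : b * eps * g2 = h / 4 by rewrite /eps; field; rewrite !gt_eqF.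
  have /eqoP/(_ eps eps0) near_small := small c c0.
  (* The two remaining errors are [B2 / (n z)^2] and [B3 / (n z)]; each is at most [e / 4] for large
     [n]. *)
  pose B2 := 4 * m * b ^+ 2 / (v ^+ 2 * g4).
  pose B3 := 4 * m' * sigma ^+ 2 * b ^+ 2 * C * g2 ^+ 2 / (h / 2) ^+ 2.
  have B20 : 0 <= B2.
    apply: divr_ge0; last by rewrite ltW// mulr_gt0// exprn_gt0.
    by apply: mulr_ge0; [exact: mulr_ge0|exact: sqr_ge0].
  near=> n.
  have n0 : (0 < n)%N by near: n; exists 1%N.
  have X1 : 1 <= n%:R * z n by near: n; exact: bigX.
  have X2 : 4 * B2 / e <= n%:R * z n by near: n; exact: bigX.
  have X3 : 4 * B3 / e <= n%:R * z n by near: n; exact: bigX.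
  have X0 : 0 < n%:R * z n by lra.
  rewrite err_sumE// lee_fin.
  have sm : \sum_(1 <= j < (Num.truncn (c * (kn n)%:R)).+1 |
      (j%:R < c * (kn n)%:R)) theta n j ^+ 2 <= eps * z n.
    have : `|\sum_(1 <= j < (Num.truncn (c * (kn n)%:R)).+1 |
      (j%:R < c * (kn n)%:R)) theta n j ^+ 2| <= eps * `|z n|.
      by near: n; exact: near_small.
    rewrite ger0_norm; last by apply: sumr_ge0 => j _; exact: sqr_ge0.
    by rewrite gtr0_norm//; exact: z0.
  have KL : kappa2 n (Num.truncn (c * (kn n)%:R)) <= L * kappa2 n (kn n).
    exact: ltW (A4 dl n dl0 n0).
  have c1' : 1 < c by rewrite /c; lra.
  have up := rej_upper iid (rho n) (K0 n) s0 n0 (reg n n0) (ltW C0) (t n)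
    (N0 := (Num.truncn (c * (kn n)%:R)).+1) v0 m0 mE m'0 m'E eta0 eta_sqr g10 g40.
  have T2 : 4 * m * b ^+ 2 / (v ^+ 2 * (g4 * (n%:R * z n) ^+ 2)) <= e / 4.
    have -> : 4 * m * b ^+ 2 / (v ^+ 2 * (g4 * (n%:R * z n) ^+ 2)) =
        B2 / (n%:R * z n) ^+ 2 by rewrite /B2 mulrA -[RHS]mulrA -invfM.
    rewrite ler_pdivrMr ?exprn_gt0//.
    move: X2; rewrite ler_pdivrMr// expr2.
    by move: X1 e0; set X := n%:R * z n; nra.
  have T3 : 4 * m' * sigma ^+ 2 * b ^+ 2 * C * g2 ^+ 2 /
      ((h / 2) ^+ 2 * (n%:R * z n)) <= e / 4.
    rewrite invfM mulrA -/B3 ler_pdivrMr//.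
    by move: X3; rewrite ler_pdivrMr//; lra.
  suff : rej xi sigma n (kappa2 n) (rho n) (theta n) (t n) <=
    rej xi sigma n (kappa2 n) (rho n) (fun=> 0) (t n) + e by lra.
  apply: le_trans (up _) _; last by rewrite lerD2l -/h; lra.
  move=> N NN.
  apply: le_trans (signal_le (reg n n0) c1' L0 (ltW eps0) b0 KL sm NN) _.
  rewrite ler_pM2r ?invr_gt0 ?exprn_gt0 ?ltr0n//.
  by rewrite -/h mulrDl beps; lra.
Unshelve. all: by end_near. Qed.
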